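(* Let $\mathcal{F}$ be convex, let $\delta>0$, and suppose that $f^*_\delta,g^*_\delta\in\mathcal{F}$ achieve the single-class modulus $\omega(\delta;\mathcal{F})$ with $\|K(f^*_\delta-g^*_\delta)\|=\delta$. Let $$\hat c_{\alpha,\delta,\mathcal{F}}=\hat L_{\delta,\mathcal{F}}-\tfrac12\left(\omega(\delta;\mathcal{F})-\delta\,\omega'(\delta;\mathcal{F})\right)-z_{1-\alpha}\,\sigma\,\omega'(\delta;\mathcal{F}).$$ Then, for $\beta=\Phi(\delta/\sigma-z_{1-\alpha})$, $\hat c_{\alpha,\delta,\mathcal{F}}$ minimizes the maximum $\beta$th quantile of excess length, $\sup_{f\in\mathcal{F}}q_{f,\beta}(Lf-\hat c)$, among all one-sided $1-\alpha$ confidence intervals $[\hat c,\infty)$ for $Lf$. The minimax excess length (the minimized value) is $\omega(\delta;\mathcal{F})$.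
   Context: Model: one observes $Y=Kf+\sigma\varepsilon$, where $f$ is known to lie in a convex subset $\mathcal{F}$ of a vector space, $K$ is a known linear operator from (the span of) $\mathcal{F}$ to a real Hilbert space $\mathcal{Y}$ with inner product $\langle\cdot,\cdot\rangle$ and norm $\|\cdot\|$, $\sigma>0$ is known, and $\varepsilon$ is standard Gaussian: for each $g\in\mathcal{Y}$, $\langle\varepsilon,g\rangle\sim\mathcal{N}(0,\|g\|^2)$. $L$ is a linear functional; the parameter of interest is $Lf$. $P_f$ denotes probability under $f$; $\alpha\in(0,1)$; $\Phi$ is the standard normal cdf and $z_q$ its $q$-quantile. A one-sided $1-\alpha$ confidence interval is $[\hat c,\infty)$ with $\hat c=\hat c(Y)$ and $\inf_{f\in\mathcal{F}}P_f(Lf\in[\hat c,\infty))\ge1-\alpha$. $q_{f,\beta}(\cdot)$ denotes the $\beta$th quantile under $P_f$. Single-class modulus: $\omega(\delta;\mathcal{F})=\sup\{Lg-Lf:\|K(g-f)\|\le\delta,\ f,g\in\mathcal{F}\}$. It is concave in $\delta$, and $\omega'(\delta;\mathcal{F})$ denotes an arbitrary (but the same throughout) element of its superdifferential $\{d:\omega(\eta;\mathcal{F})\le\omega(\delta;\mathcal{F})+d(\eta-\delta)\text{ for all }\eta>0\}$. With $f^*_{M,\delta}=(f^*_\delta+g^*_\delta)/2$, $$\hat L_{\delta,\mathcal{F}}=Lf^*_{M,\delta}+\frac{\omega'(\delta;\mathcal{F})}{\delta}\langle K(g^*_\delta-f^*_\delta),\,Y-Kf^*_{M,\delta}\rangle.$$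 *)

(* Defs.v *)
From HB Require Import structures.
From mathcomp Require Import all_boot all_order all_algebra.
From mathcomp Require Import all_classical all_reals all_analysis.

Set Implicit Arguments.
Unset Strict Implicit.
Unset Printing Implicit Defensive.

Import Order.TTheory GRing.Theory Num.Theory.
Import numFieldNormedType.Exports.

Local Open Scope classical_set_scope.
Local Open Scope ring_scope.

Section Laws.
Variable R : realType.

Definition quantile (mu : set R -> \bar R) (b : R) : R :=
  inf [set t : R | (b%:E <= mu `]-oo, t]%classic)%E].

Definition Phi (t : R) : R := fine (normal_prob (0 : R) 1 `]-oo, t]%classic).

Definition z_ (q : R) : R := quantile (normal_prob (0 : R) 1) q.

(* N(0, s^2). The case s = 0 is separate because [normal_prob 0 0] is the
   uniform law on [0, 1] in the library, not the point mass at 0. *)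
Definition centered_normal (s : R) : set R -> \bar R :=
  if s == 0 then \d_(0 : R) else normal_prob (0 : R) s.

End Laws.

Section Noise.
Context (R : realType) (H : completeNormedModType R).
Context d (Omega : measurableType d) (P : probability Omega R).

(* [W g] plays the role of <eps, g>. In infinite dimension eps is not an
   H-valued random element, and <eps, a g + h> = a <eps, g> + <eps, h> is only
   meaningful almost surely; this covers surely linear versions too. *)
Definition standard_gaussian (W : H -> {RV P >-> R}) : Prop :=
  (forall (a : R) (g h : H),
     {ae P, forall w, W (a *: g + h) w = a * W g w + W h w}) /\
  (forall (g : H) (A : set R), measurable A ->
     distribution P (W g) A = centered_normal `|g| A).

End Noise.

Section Data.
Context (R : realType) (H : completeNormedModType R).

(* A data point y stands for Y through all its coordinates y g = <Y, g>. *)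
Definition cylinders : set (set (H -> R)) :=
  [set C | exists (g : H) (B : set R),
     measurable B /\ C = [set y : H -> R | B (y g)]].

Definition data : Type := g_sigma_algebraType cylinders.

HB.instance Definition _ := Measurable.on data.

End Data.
Arguments data {R} H.

Section Modulus.
Context (R : realType) (V : lmodType R) (H : completeNormedModType R).
Context (K : {linear V -> H}) (L : {scalar V}) (F : set V).

Definition modulus (delta : R) : \bar R :=
  ereal_sup [set x | exists f g : V,
    [/\ F f, F g, `|K (g - f)| <= delta & x = (L g - L f)%:E]].

Definition superdifferential (delta : R) : set R :=
  [set s | forall eta : R, 0 < eta ->
     (modulus eta <= modulus delta + (s * (eta - delta))%:E)%E].

Definition attains_modulus (delta : R) (fs gs : V) : Prop :=
  [/\ F fs, F gs, `|K (gs - fs)| <= delta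
    & (L gs - L fs)%:E = modulus delta].

Context (ip : {dot H for (@idfun R)}).

Definition L_hat (delta slope : R) (fs gs : V) (y : data H) : R :=
  let fM := 2^-1 *: (fs + gs) in
  L fM + slope / delta * (y (K (gs - fs)) - ip (K (gs - fs)) (K fM)).

Definition c_hat (sigma alpha delta slope : R) (fs gs : V) (y : data H) : R :=
  L_hat delta slope fs gs y
  - 2^-1 * (fine (modulus delta) - delta * slope)
  - z_ (1 - alpha) * sigma * slope.

End Modulus.

Section Inference.
Context (R : realType) (V : lmodType R) (H : completeNormedModType R).
Context (K : {linear V -> H}) (L : {scalar V}) (F : set V).
Context (ip : {dot H for (@idfun R)}).
Context d (Omega : measurableType d) (P : probability Omega R).
Context (W : H -> {RV P >-> R}) (sigma : R).

(* <Y, g> = <K f, g> + sigma <eps, g>; probability under f is the law of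
   [observe f] under P. *)
Definition observe (f : V) (w : Omega) : data H :=
  fun g => ip (K f) g + sigma * W g w.

Definition one_sided_ci (alpha : R) (c : data H -> R) : Prop :=
  measurable_fun [set: data H] c /\
  ((1 - alpha)%:E <= ereal_inf
     [set P [set w | L f \in `[c (observe f w), +oo[ ] | f in F])%E.

Definition excess_quantile (beta : R) (c : data H -> R) (f : V) : R :=
  quantile (pushforward P (fun w => L f - c (observe f w))) beta.

Definition max_excess_quantile (beta : R) (c : data H -> R) : \bar R :=
  ereal_sup [set (excess_quantile beta c f)%:E | f in F].

End Inference.

(* Main.v *)
(* Put h = K (gs - fs). Convexity of F and the superdifferential inequality give
   L fs + (slope / delta) <h, K (f - fs)> <= L f <=
   L gs + (slope / delta) <h, K (f - gs)> for f in F, so the excess length of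
   c_hat at f is a normal variable with standard deviation slope * sigma whose
   mean is smallest at fs (coverage) and largest at gs (excess length).

   For optimality, if the beta-quantile of L gs - c were below the modulus, the
   test "L gs - c <= t", for some t below the modulus, would have power at least
   beta at gs and level alpha at a point of the segment [fs, gs] at distance
   strictly less than delta from gs, which Neyman-Pearson forbids. In infinite
   dimension the likelihood ratio is avoided: the law of the data is unchanged
   if the noise along u = h / |h| is resampled independently, so conditionally
   on the rest only a one-dimensional shift has to be tested.

   That the resampled process has the same law follows from its having the same
   trigonometric integrals. These determine the law without Fourier inversion,
   because the indicator of a half-space {y g >= b} is an iterated bounded limit
   of polynomials in sin ((y g - b) / N). *)
Require Import Defs.
From HB Require Import structures.
From mathcomp Require Import all_boot all_order all_algebra.
From mathcomp Require Import all_classical all_reals all_analysis.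
From mathcomp Require Import measurable_realfun.
From mathcomp Require Import ring lra.

Set Implicit Arguments.
Unset Strict Implicit.
Unset Printing Implicit Defensive.

Import Order.TTheory GRing.Theory Num.Theory.
Import numFieldNormedType.Exports.

Local Open Scope classical_set_scope.
Local Open Scope ring_scope.

(** * Lebesgue measure under translation and integrals against the normal law *)

Section Normal.
Context {R : realType}.
Local Notation mu := (@lebesgue_measure R).
Implicit Types (a b m r s t x : R).

Lemma measurable_cos : measurable_fun setT (@cos R).
Proof. by apply: continuous_measurable_fun; exact: continuous_cos. Qed.

Lemma measurable_sin : measurable_fun setT (@sin R).
Proof. by apply: continuous_measurable_fun; exact: continuous_sin. Qed.

Lemma measurable_addr a : measurable_fun [set: R] (fun x : R => x + a).
Proof. by apply: measurable_funD. Qed.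

Lemma lebesgue_measure_addr a (A : set R) :
  measurable A -> mu ((fun x => x + a) @^-1` A) = mu A.
Proof.
move=> mA; have ma := measurable_addr a.
rewrite -[LHS]/(pushforward mu ((fun x => x + a) : R -> measurableTypeR R) A).
symmetry; apply: lebesgue_measure_unique => //.
move=> _ [[u v] /= _ <-]; rewrite /pushforward.
rewrite (_ : _ @^-1` _ = `]u - a, v - a]%classic); last first.
  by apply/seteqP; split => x /=; rewrite !in_itv/= ltrBlDr lerBrDr.
rewrite !lebesgue_measure_itv/= !lte_fin ltrD2r.
by case: ifP => // _; rewrite -!EFinB; congr (_%:E); ring.
Qed.

Lemma ge0_integral_addr a (f : R -> \bar R) :
  measurable_fun setT f -> (forall x, 0 <= f x)%E ->
  (\int[mu]_x f (x + a)%R = \int[mu]_x f x)%E.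
Proof.
move=> mf f0; have ma := measurable_addr a.
have /= <- := @ge0_integral_pushforward _ _ (measurableTypeR R)
  (measurableTypeR R) R _ ma mu setT f measurableT mf.
  by apply: eq_measure_integral => A mA _; exact: lebesgue_measure_addr.
by move=> x _; exact: f0.
Qed.

(** Over measurable sets [normal_pdf m s] integrates to [normal_prob m s], so it agrees almost
    everywhere with the Radon-Nikodym derivative, and the change of variables formula applies. *)
Lemma integral_normal_prob m s (D : set R) (f : R -> \bar R) :
  measurable D -> (normal_prob m s).-integrable D f ->
  (\int[normal_prob m s]_(x in D) f x =
   \int[mu]_(x in D) (f x * (normal_pdf m s x)%:E))%E.
Proof.
move=> mD intf; have dom := @normal_prob_dominates R m s.
rewrite -(Radon_Nikodym_change_of_variables dom)//=.
have mf := measurable_int _ intf.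
have mp : measurable_fun D (EFin \o normal_pdf m s).
  by apply/measurable_EFinP/measurable_funTS; exact: measurable_normal_pdf.
apply: ae_eq_integral => //.
- apply: emeasurable_funM => //; apply: (measurable_int mu).
  apply: (integrableS _ _ (@subsetT _ _)) => //=.
  by apply: Radon_Nikodym_integrable; exact: normal_prob_dominates.
- exact: (emeasurable_funM mf mp).
- apply: ae_eqe_mul2l; rewrite Radon_NikodymE//=.
  case: cid => /= h [h1 h2 h3].
  apply: integral_ae_eq => //=.
  + exact: integrableS h2.
  + by move=> E _ mE; rewrite -h3.
Qed.

(** * Cosine integrals of the standard normal density *)

Lemma normal01E x : normal_pdf (0 : R) 1 x = normal_peak 1 * expR (- x ^+ 2 / 2).
Proof. by rewrite normal_pdfE ?oner_eq0// /normal_fun subr0 expr1n. Qed.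

(* [normal_fun 0 (sqrt 2)] is [exp (- x^2 / 4)], the integrable majorant for
   differentiation under the integral sign. *)
Lemma normal_first_moment_le x :
  `|x| * expR (- x ^+ 2 / 2) <= normal_fun 0 (Num.sqrt 2) x.
Proof.
have -> : normal_fun 0 (Num.sqrt 2) x = expR (- x ^+ 2 / (2 * 2)).
  by rewrite /normal_fun subr0 sqr_sqrtr//; congr (expR (_ / _)); ring.
have -> : - x ^+ 2 / 2 = - x ^+ 2 / (2 * 2) + - x ^+ 2 / (2 * 2) :> R by field.
rewrite expRD mulrA ler_piMl ?expR_ge0//.
rewrite mulNr expRN ler_pdivrMr ?expR_gt0// mul1r.
apply: le_trans (expR_ge1Dx _).
have : 0 <= (`|x| / 2 - 1) ^+ 2 by exact: sqr_ge0.
rewrite -[x ^+ 2]real_normK ?num_real//; nra.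
Qed.

Lemma integrable_normal_fun m s : s != 0 ->
  mu.-integrable setT (fun x => (normal_fun m s x)%:E).
Proof.
move=> s0; have := integrable_normal_pdf m s.
rewrite normal_pdfE// => /(integrableZl measurableT (normal_peak s)^-1).
apply: eq_integrable => // x _ /=.
by rewrite -EFinM mulKf// gt_eqF// normal_peak_gt0.
Qed.

Lemma derive_cos_pdf r t x :
  is_derive r 1 (fun r : R => cos (r * x + t) * normal_pdf 0 1 x)
    (- x * sin (r * x + t) * normal_pdf 0 1 x).
Proof.
apply: is_derive_eq; rewrite /GRing.scale/=; ring.
Qed.

Lemma derive_sin_pdf r t x :
  is_derive x 1 (fun x : R => sin (r * x + t) * normal_pdf 0 1 x)
    ((r * cos (r * x + t) - x * sin (r * x + t)) * normal_pdf 0 1 x).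
Proof.
rewrite (_ : normal_pdf 0 1 = fun x => normal_peak 1 * expR (- x ^+ 2 / 2)); last first.
  by apply/funext => y; rewrite normal01E.
by apply: is_derive_eq; rewrite /GRing.scale/=; field.
Qed.


(** Integration by parts with vanishing boundary terms: the fundamental theorem of calculus on
    [[-n, n]], then dominated convergence. *)
Lemma integral_derive_eq0 (g g' : R -> R) :
  (forall x, is_derive x 1 g (g' x)) -> continuous g' ->
  mu.-integrable setT (EFin \o g') ->
  (g n%:R - g (- n%:R)) @[n --> \oo] --> (0 : R) ->
  (\int[mu]_x (g' x)%:E = 0)%E.
Proof.
move=> dg cg' ig' g0.
pose f_ n x := (g' x * \1_`[- n%:R, n%:R] x)%:E : \bar R.
have : (\int[mu]_x f_ n x @[n --> \oo] --> \int[mu]_x (g' x)%:E)%E.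
  apply: (@dominated_cvg _ _ _ mu _ _ _ _ (abse \o (EFin \o g'))) => //=.
  - move=> n; apply/measurable_EFinP; apply: measurable_funM.
      by move/measurable_int/measurable_EFinP : ig'.
    exact: measurable_indic.
  - move=> x _; apply: cvg_near_cst; near=> n.
    rewrite /f_ indicE mem_set ?mulr1//= in_itv/= -ler_norml.
    by near: n; exact: nbhs_infty_ger.
  - exact: integrable_abse ig'.
  - move=> n x _; rewrite /f_ indicE lee_fin normrM ler_piMr//.
    by case: (_ \in _); rewrite ?normr1 ?normr0.
(* The index is shifted so that the interval is nondegenerate, as the fundamental theorem
   requires. *)
have fE n : (\int[mu]_x f_ n.+1 x = (g n.+1%:R - g (- n.+1%:R))%:E)%E.
  have -> : (\int[mu]_x f_ n.+1 x = 
      \int[mu]_(x in `[(- n.+1%:R)%R, n.+1%:R]) (g' x)%:E)%E.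
    rewrite [RHS]integral_mkcond; apply: eq_integral => x _.
    rewrite /f_ patchE indicE; case: ifPn => _; rewrite ?mulr1 ?mulr0//.
  rewrite (@continuous_FTC2 _ _ g) ?EFinB//.
  - by rewrite -subr_gt0 opprK; rewrite ltr_pwDl.
  - exact: continuous_subspaceT.
  - split=> [x _||].
    + by have [] := dg x.
    + apply: cvg_at_right_filter; apply: differentiable_continuous.
      by apply/derivable1_diffP; have [] := dg (- n.+1%:R).
    + apply: cvg_at_left_filter; apply: differentiable_continuous.
      by apply/derivable1_diffP; have [] := dg n.+1%:R.
  - by move=> x _; rewrite derive1E; have [] := dg x.
rewrite -(cvg_shiftS (fun n => \int[mu]_x f_ n x)%E) => fcvg.
apply: (cvg_unique _ fcvg) => //.
rewrite (_ : (fun n => _) = EFin \o (fun n => g n.+1%:R - g (- n.+1%:R))); last first.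
  by apply/funext => n; rewrite fE.
apply: cvg_EFin; first exact: nearW.
by rewrite (cvg_shiftS (fun n => g n%:R - g (- n%:R))).
Unshelve. all: by end_near. Qed.

(** Follows from [1 + y <= expR y] and [n <= n ^ 2]; a harmonic rate suffices to make the boundary
    terms vanish. *)
Lemma normal_tail_le (n : nat) :
  expR (- n%:R ^+ 2 / 2) <= 2 * harmonic n :> R.
Proof.
rewrite mulNr expRN -[_^-1]mul1r ler_pdivrMr ?expR_gt0// mulrAC -mulrA mulrC.
rewrite mulrAC ler_pdivlMr ?mul1r//.
apply: (@le_trans _ _ (2 * (1 + n%:R ^+ 2 / 2))); last first.
  by rewrite mulrC ler_pM2r//; exact: expR_ge1Dx.
have n2 : n%:R <= n%:R ^+ 2 :> R.
  by rewrite -natrX ler_nat; case: (n) => // k; rewrite expnS leq_pmulr.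
rewrite -natr1; lra.
Qed.

Lemma integrable_cos_pdf r t :
  mu.-integrable setT (fun x => (cos (r * x + t) * normal_pdf 0 1 x)%:E).
Proof.
apply: (le_integrable measurableT _ _ (integrable_normal_pdf 0 1)).
  apply/measurable_EFinP; apply: measurable_funM; last exact: measurable_normal_pdf.
  apply: measurableT_comp; first exact: measurable_cos.
  by apply: measurable_funD => //; exact: measurable_funM.
move=> x _; rewrite lee_fin normrM ler_piMl//; exact: cos_max.
Qed.

Lemma sin_moment_pdf_le r t x :
  `|x * sin (r * x + t) * normal_pdf 0 1 x|
  <= normal_peak 1 * normal_fun 0 (Num.sqrt 2) x.
Proof.
rewrite normal01E !normrM mulrCA ger0_norm ?normal_peak_ge0//.
rewrite ler_wpM2l ?normal_peak_ge0//; apply: le_trans (normal_first_moment_le x).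
rewrite [X in _ * X]ger0_norm ?expR_ge0//.
by rewrite ler_wpM2r ?expR_ge0// ler_piMr//; exact: sin_max.
Qed.

Lemma integrable_sin_moment_pdf r t :
  mu.-integrable setT (fun x => (x * sin (r * x + t) * normal_pdf 0 1 x)%:E).
Proof.
have s2 : Num.sqrt 2 != 0 :> R by rewrite gt_eqF// sqrtr_gt0.
have := integrableZl measurableT (normal_peak 1) (integrable_normal_fun 0 s2).
apply: le_integrable => //.
  apply/measurable_EFinP; apply: measurable_funM; last exact: measurable_normal_pdf.
  apply: measurable_funM => //; apply: measurableT_comp; first exact: measurable_sin.
  by apply: measurable_funD => //; exact: measurable_funM.
move=> x _; rewrite lee_fin (le_trans (sin_moment_pdf_le _ _ _))//.
exact: ler_norm.
Qed.

(** Differentiation under the integral gives minus the integral of [x * sin (r * x + t)] against the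
    density. Since the derivative of [sin (r * x + t) * normal_pdf 0 1 x] integrates to zero, this
    is [- r] times the cosine integral. *)
Lemma is_derive_integral_cos_pdf r t :
  is_derive r 1 (fun r => \int[mu]_x (cos (r * x + t) * normal_pdf 0 1 x))
    (- r * \int[mu]_x (cos (r * x + t) * normal_pdf 0 1 x)).
Proof.
have s2 : Num.sqrt 2 != 0 :> R by rewrite gt_eqF// sqrtr_gt0.
have p1 s x : partial1of2 (fun (r : R) x => cos (r * x + t) * normal_pdf 0 1 x) s x
    = - (x * sin (s * x + t) * normal_pdf 0 1 x).
  by rewrite partial1of2E; have [_ ->] := derive_cos_pdf s t x; rewrite !mulNr.
(* The majorant of the derivative in [r] does not depend on [r], so any open interval around [r]
   serves. *)
have ri : `]r - 1, r + 1[%classic r by rewrite /= in_itv/=; apply/andP; split; lra.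
have iG := integrableZl measurableT (normal_peak 1) (integrable_normal_fun 0 s2).
have d x y : `]r - 1, r + 1[%classic x -> [set: R] y ->
    derivable ((fun (r : R) x => cos (r * x + t) * normal_pdf 0 1 x)^~ y) x 1.
  by move=> _ _; have [] := derive_cos_pdf x t y.
have ub x y : `]r - 1, r + 1[%classic x -> [set: R] y ->
    `|partial1of2 (fun (r : R) x => cos (r * x + t) * normal_pdf 0 1 x) x y| <=
    normal_peak 1 * normal_fun 0 (Num.sqrt 2) y.
  by move=> _ _; rewrite p1 normrN sin_moment_pdf_le.
have G0 y : 0 <= normal_peak 1 * normal_fun 0 (Num.sqrt 2) y :> R.
  by rewrite mulr_ge0 ?normal_peak_ge0 ?normal_fun_ge0.
have ic x : `]r - 1, r + 1[%classic x -> mu.-integrable setT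
    (EFin \o (fun y => cos (x * y + t) * normal_pdf 0 1 y)).
  by move=> _; exact: integrable_cos_pdf.
apply: DeriveDef.
  exact: (derivable_under_integral measurableT ri ic d G0 iG ub).
rewrite -derive1E (differentiation_under_integral measurableT ri ic d G0 iG ub).
under eq_Rintegral do rewrite p1.
have ipr : mu.-integrable setT (EFin \o (fun x =>
    (r * cos (r * x + t) - x * sin (r * x + t)) * normal_pdf 0 1 x)).
  have := integrableB measurableT (integrableZl measurableT r (integrable_cos_pdf r t))
    (integrable_sin_moment_pdf r t).
  apply: eq_integrable => // x _ /=; rewrite -EFinM -EFinB; congr EFin; ring.
have I0 : \int[mu]_x ((r * cos (r * x + t) - x * sin (r * x + t)) * normal_pdf 0 1 x) = 0.
  rewrite /Rintegral (integral_derive_eq0 (derive_sin_pdf r t))//.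
  - move=> x; have clin : (r * y + t) @[y --> x] --> r * x + t.
      by apply: cvgD; [apply: cvgM; [exact: cvg_cst|exact: cvg_id]|exact: cvg_cst].
    apply: cvgM; last by apply: continuous_normal_pdf; exact: oner_neq0.
    apply: cvgB; (apply: cvgM; first by [exact: cvg_cst|exact: cvg_id]).
      by apply: (cvg_comp _ _ clin); exact: continuous_cos.
    by apply: (cvg_comp _ _ clin); exact: continuous_sin.
  (* Boundary terms: two sines bounded by 1, times a density at [n] bounded by
     [normal_peak 1 * (2 * harmonic n)], whence the factor 4. *)
  - apply: (@squeeze_cvgr _ _ _ _ (fun n => - (4 * normal_peak 1 * harmonic n))
      (fun n => 4 * normal_peak 1 * harmonic n)).
    + apply: nearW => n; rewrite -ler_norml.
      rewrite !normal01E sqrrN -mulrBl normrM.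
      rewrite [X in _ * X]ger0_norm ?mulr_ge0 ?normal_peak_ge0 ?expR_ge0//.
      have -> : 4 * normal_peak 1 * harmonic n = 2 * (normal_peak 1 * (2 * harmonic n)) :> R.
        by ring.
      apply: ler_pM; [exact: normr_ge0|by rewrite mulr_ge0 ?normal_peak_ge0 ?expR_ge0| |].
        rewrite (le_trans (ler_normB _ _))// [leRHS]mulr2n.
        by apply: lerD; exact: sin_max.
      by rewrite ler_wpM2l ?normal_peak_ge0 ?normal_tail_le.
    + rewrite -oppr0 -(mulr0 (4 * normal_peak 1)); apply: cvgN; apply: cvgMr.
      exact: cvg_harmonic.
    + rewrite -(mulr0 (4 * normal_peak 1)); apply: cvgMr; exact: cvg_harmonic.
have E : \int[mu]_x (r * (cos (r * x + t) * normal_pdf 0 1 x)) =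
   \int[mu]_x (x * sin (r * x + t) * normal_pdf 0 1 x).
  apply/eqP; rewrite -subr_eq0 -RintegralB//; last 2 first.
  - exact: integrableZl (integrable_cos_pdf r t).
  - exact: integrable_sin_moment_pdf.
  rewrite -[X in _ == X]I0; apply/eqP; apply: eq_Rintegral => x _; ring.
rewrite mulNr -RintegralZl//; last exact: integrable_cos_pdf.
rewrite E -[RHS]mulN1r -RintegralZl//; last exact: integrable_sin_moment_pdf.
by apply: eq_Rintegral => x _; rewrite mulN1r.
Qed.

(** As a function of [r] the integral solves [F' = - r F], so [F r * expR (r ^+ 2 / 2)] is constant;
    at [r = 0] it equals [cos t]. *)
Lemma integral_cos_normal r t :
  \int[normal_prob 0 1]_x cos (r * x + t) = cos t * expR (- r ^+ 2 / 2).
Proof.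
have -> : \int[normal_prob 0 1]_x cos (r * x + t)
    = \int[mu]_x (cos (r * x + t) * normal_pdf 0 1 x).
  rewrite /Rintegral integral_normal_prob//.
  apply: measurable_bounded_integrable => //.
  - by rewrite -ge0_fin_numE ?fin_num_measure.
  - apply: measurableT_comp; first exact: measurable_cos.
    by apply: measurable_funD => //; exact: measurable_funM.
  - exists 1; split => // u u1 x _ /=; apply: le_trans (ltW u1); exact: cos_max.
pose F r := \int[mu]_x (cos (r * x + t) * normal_pdf 0 1 x).
have dF s : is_derive s 1 F (- s * F s) by exact: is_derive_integral_cos_pdf.
have dFe s : is_derive s 1 (fun s => F s * expR (s ^+ 2 / 2)) 0.
  by apply: is_derive_eq; rewrite /GRing.scale/=; field.
have := is_derive_0_is_cst r 0 dFe.
rewrite expr0n mul0r expR0 mulr1 -/(F r) => FE.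
rewrite mulNr expRN -(mulfK (lt0r_neq0 (expR_gt0 (r ^+ 2 / 2))) (F r)) FE; congr (_ * _).
rewrite /F; under eq_Rintegral do rewrite mul0r add0r.
rewrite RintegralZl//; last exact: integrable_normal_pdf.
by rewrite /Rintegral integral_normal_pdf mulr1.
Qed.

(** * Reflection, translation and Neyman-Pearson for the standard normal law *)

Lemma ge0_integral_opp (f : R -> \bar R) :
  measurable_fun setT f -> (forall x, 0 <= f x)%E ->
  (\int[mu]_x f (- x)%R = \int[mu]_x f x)%E.
Proof.
move=> mf f0; have mN : measurable_fun [set: R] (-%R : R -> R) by exact: oppr_measurable.
have /= <- := @ge0_integral_pushforward _ _ (measurableTypeR R)
  (measurableTypeR R) R _ mN mu setT f measurableT mf.
  by apply: eq_measure_integral => A mA _; exact: lebesgue_measureN.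
by move=> x _; exact: f0.
Qed.

Lemma normal_probE (A : set R) : measurable A ->
  normal_prob 0 1 A = (\int[mu]_x (\1_A x * normal_pdf 0 1 x)%:E)%E.
Proof.
move=> mA; rewrite /normal_prob integral_mkcond; apply: eq_integral => x _.
by rewrite patchE indicE; case: ifP; rewrite ?mul1r ?mul0r.
Qed.

Lemma measurable_indicM_pdf a (A : set R) : measurable A ->
  measurable_fun setT (fun x => (\1_A x * normal_pdf a 1 x)%:E).
Proof.
move=> mA; apply/measurable_EFinP; apply: measurable_funM.
  exact: measurable_indic.
exact: measurable_normal_pdf.
Qed.

Lemma indicM_pdf_ge0 a (A : set R) x :
  (0 <= (\1_A x * normal_pdf a 1 x)%:E :> \bar R)%E.
Proof. by rewrite lee_fin mulr_ge0// normal_pdf_ge0. Qed.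

Lemma normal_prob_opp (A : set R) : measurable A ->
  normal_prob (0 : R) 1 (-%R @^-1` A) = normal_prob 0 1 A.
Proof.
move=> mA; rewrite !normal_probE//; last first.
  by rewrite -[X in measurable X]setTI; exact: oppr_measurable.
rewrite -(ge0_integral_opp (measurable_indicM_pdf 0 mA) (indicM_pdf_ge0 0 A)).
by apply: eq_integral => x _; rewrite !normal01E sqrrN.
Qed.

Lemma normal_prob_addr a (A : set R) : measurable A ->
  normal_prob (0 : R) 1 ((fun x => x + a) @^-1` A) =
  (\int[mu]_x (\1_A x * normal_pdf a 1 x)%:E)%E.
Proof.
move=> mA; rewrite normal_probE//; last first.
  by rewrite -[X in measurable X]setTI; exact: measurable_addr.
rewrite -(ge0_integral_addr a (measurable_indicM_pdf a mA) (indicM_pdf_ge0 a A)).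
apply: eq_integral => x _; congr (_ * _)%:E.
by rewrite !normal_pdfE ?oner_eq0//; congr (_ * _); rewrite /normal_fun subr0 addrK.
Qed.

Lemma normal_pdf_addr a x :
  normal_pdf a 1 x = expR (a * x - a ^+ 2 / 2) * normal_pdf 0 1 x.
Proof.
rewrite normal01E mulrCA -expRD normal_pdfE ?oner_eq0//; congr (_ * expR _).
by rewrite expr1n; field.
Qed.

(** The likelihood ratio of the law shifted by [a] is nondecreasing because [0 <= a], and the weight
    is its value at [z]; so the half-line beats [B] pointwise under the integral. Both sides are
    sums of nonnegative terms, which avoids subtraction in the extended reals. *)
Lemma neyman_pearson_normal a (z : R) (B : set R) : 0 <= a -> measurable B ->
  (normal_prob (0 : R) 1 ((fun x => x + a)%R @^-1` B) +
     (expR (a * z - a ^+ 2 / 2))%:E * normal_prob (0 : R) 1 `[z, +oo[ <=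
   normal_prob (0 : R) 1 ((fun x => x + a)%R @^-1` `[z, +oo[) +
     (expR (a * z - a ^+ 2 / 2))%:E * normal_prob (0 : R) 1 B)%E.
Proof.
move=> a0 mB; set k := expR _; have k0 : 0 <= k by exact: expR_ge0.
have mk (A : set R) : measurable A ->
    measurable_fun setT (fun x => k%:E * (\1_A x * normal_pdf 0 1 x)%:E)%E.
  by move=> mA; apply: emeasurable_funM => //; exact: measurable_indicM_pdf.
have k_ge0 (A : set R) x : (0 <= k%:E * (\1_A x * normal_pdf 0 1 x)%:E)%E.
  by apply: mule_ge0 => //; exact: indicM_pdf_ge0.
have E (A C : set R) : measurable A -> measurable C ->
    (normal_prob (0 : R) 1 ((fun x => x + a)%R @^-1` A) + k%:E * normal_prob (0 : R) 1 C =
    \int[mu]_x ((\1_A x * normal_pdf a 1 x)%:E + k%:E * (\1_C x * normal_pdf 0 1 x)%:E))%E.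
  move=> mA mC; rewrite normal_prob_addr// normal_probE// -ge0_integralZl//=.
  - rewrite -ge0_integralD//=.
    + by move=> x _; exact: indicM_pdf_ge0.
    + exact: measurable_indicM_pdf.
    + exact: mk.
  - exact: measurable_indicM_pdf.
  - by move=> x _; exact: indicM_pdf_ge0.
rewrite !E//.
apply: ge0_le_integral => //.
- by move=> x _; rewrite adde_ge0 ?indicM_pdf_ge0 ?k_ge0.
- by apply: emeasurable_funD; [exact: measurable_indicM_pdf|exact: mk].
- by apply: emeasurable_funD; [exact: measurable_indicM_pdf|exact: mk].
move=> x _; rewrite -!EFinM -!EFinD lee_fin normal_pdf_addr.
set p := normal_pdf 0 1 x; have p0 : 0 <= p by exact: normal_pdf_ge0.
set e := expR (a * x - _).
have I01 (A : set R) : 0 <= (\1_A x : R) <= 1.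
  by rewrite indicE; case: (_ \in _); rewrite lexx ler01.
have /andP[B0 B1] := I01 B.
have [zx|xz] := leP z x.
  have -> : \1_`[z, +oo[%classic x = 1 :> R.
    by rewrite indicE mem_set//= in_itv/= zx.
  have ke : k <= e by rewrite ler_expR lerD2r ler_wpM2l.
  have : 0 <= (1 - \1_B x) * (e - k) * p by rewrite !mulr_ge0// subr_ge0.
  by move: (\1_B x) => b; nra.
have -> : \1_`[z, +oo[%classic x = 0 :> R.
  by rewrite indicE memNset//= in_itv/= andbT; apply/negP; rewrite -ltNge.
have ek : e <= k by rewrite ler_expR lerD2r ler_wpM2l// ltW.
have : 0 <= \1_B x * (k - e) * p by rewrite !mulr_ge0// subr_ge0.
by move: (\1_B x) => b; nra.
Qed.

(** * Monotonicity and range of [Phi] *)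

Lemma PhiE t : (Phi t)%:E = normal_prob (0 : R) 1 `]-oo, t].
Proof. by rewrite /Phi fineK// fin_num_measure. Qed.

Lemma normal_prob_itvcy t : normal_prob (0 : R) 1 `[t, +oo[ = (Phi (- t))%:E.
Proof.
rewrite PhiE -normal_prob_opp//; congr (normal_prob _ _ _).
by apply/seteqP; split=> x /=; rewrite !in_itv/= andbT lerNr.
Qed.

Lemma Phi_lt : {homo (@Phi R) : x y / x < y}.
Proof.
move=> a b ab; rewrite -lte_fin !PhiE.
rewrite (_ : `]-oo, b]%classic = `]-oo, a] `|` `]a, b]); last first.
  by rewrite -itv_bndbnd_setU// bnd_simp// ltW.
rewrite measureU//; last first.
  by apply/seteqP; split=> x //=; rewrite !in_itv/=; lra.
rewrite lteDl ?fin_num_measure//.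
(* A positive lower bound for the density on []a, b]], where [x ^+ 2 <= a ^+ 2 + b ^+ 2]. *)
pose c := normal_peak 1 * expR (- (a ^+ 2 + b ^+ 2) / 2) : R.
have c0 : 0 < c by rewrite mulr_gt0 ?expR_gt0// normal_peak_gt0 ?oner_eq0.
apply: (@lt_le_trans _ _ (\int[mu]_(x in `]a, b]) c%:E)%E).
  rewrite integral_cst//= lebesgue_measure_itv/= lte_fin ab.
  by rewrite -EFinB -EFinM lte_fin mulr_gt0// subr_gt0.
apply: ge0_le_integral => //.
- by move=> x _; rewrite lee_fin ltW.
- by apply/measurable_EFinP/measurable_funTS; exact: measurable_normal_pdf.
move=> x; rewrite /= in_itv/= => /andP[ax xb].
rewrite lee_fin normal01E ler_wpM2l ?normal_peak_ge0// ler_expR.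
by rewrite ler_pM2r// lerN2; have [x0|x0] := leP 0 x; nra.
Qed.

Lemma Phi_le : {homo (@Phi R) : x y / x <= y}.
Proof. by move=> x y; rewrite le_eqVlt => /predU1P[->//|/Phi_lt/ltW]. Qed.

Lemma Phi_gt0 t : 0 < Phi t.
Proof.
apply: (@le_lt_trans _ _ (Phi (t - 1))); last by apply: Phi_lt; lra.
by rewrite fine_ge0.
Qed.

Lemma Phi_lt1 t : Phi t < 1.
Proof.
apply: (@lt_le_trans _ _ (Phi (t + 1))); first by apply: Phi_lt; lra.
by rewrite -lee_fin PhiE probability_le1.
Qed.

End Normal.

(** * Quantiles of a probability on the line *)

Section Quantile.
Context {R : realType} (P : probability (measurableTypeR R) R) (q : R).
Hypotheses (q_gt0 : 0 < q) (q_lt1 : q < 1).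
Local Notation S := [set t : R | (q%:E <= P `]-oo, t]%classic)%E].

(** The distribution function tends to 1 at [+oo] and to 0 at [-oo]. Hence [inf] in the definition
    of [quantile] is a genuine infimum and not a default value. *)
Lemma quantile_has_inf : has_inf S.
Proof.
split.
  have : P `]-oo, n%:R]%classic @[n --> \oo] --> P setT.
    rewrite (_ : setT = \bigcup_n `]-oo, n%:R]%classic); last first.
      apply/seteqP; split=> // x _; exists (Num.truncn `|x|).+1 => //=.
      by rewrite in_itv/= (le_trans (ler_norm _))// ltW// truncnS_gt.
    apply: nondecreasing_cvg_mu => //.
      by apply: bigcup_measurable.
    move=> m n mn; apply/subsetPset => x /=; rewrite !in_itv/= => /le_trans; apply.
    by rewrite ler_nat.
  rewrite probability_setT => /fine_cvgP[_] /cvgr_gt/(_ _ q_lt1)[N _ /(_ N (leqnn _))] /= qN.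
  by exists N%:R => /=; rewrite -[leRHS]fineK ?fin_num_measure// lee_fin ltW.
have : P `]-oo, - n%:R]%classic @[n --> \oo] --> P set0.
  rewrite (_ : set0 = \bigcap_n `]-oo, - n%:R]%classic); last first.
    apply/seteqP; split=> // x /(_ (Num.truncn `|x|).+1 I) /=.
    rewrite in_itv/= lerNr => h; have := truncnS_gt `|x|.
    by rewrite ltNge (le_trans h)// -normrN ler_norm.
  apply: nonincreasing_cvg_mu => //.
  - by rewrite -ge0_fin_numE ?fin_num_measure.
  - by apply: bigcap_measurable.
  - move=> m n mn; apply/subsetPset => x /=; rewrite !in_itv/= => /le_trans; apply.
    by rewrite lerN2 ler_nat.
rewrite measure0 => /fine_cvgP[_] /cvgr_lt/(_ _ q_gt0)[N _ /(_ N (leqnn _))] /= qN.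
exists (- N%:R) => t /= qt; rewrite leNgt; apply/negP => tN.
move: qN; rewrite ltNge => /negP; apply; rewrite -lee_fin fineK ?fin_num_measure//.
apply: (le_trans qt); apply: le_measure; rewrite ?inE//.
by move=> x /=; rewrite !in_itv/= => /le_trans; apply; exact: ltW.
Qed.

(** Right continuity of the distribution function: each [z + n.+1%:R^-1] lies above some point of
    the set. *)
Lemma quantile_le_prob : (q%:E <= P `]-oo, quantile P q]%classic)%E.
Proof.
set z := quantile P q.
have h : P `]-oo, z + n.+1%:R^-1]%classic @[n --> \oo] --> P `]-oo, z]%classic.
  rewrite (_ : `]-oo, z]%classic = \bigcap_n `]-oo, z + n.+1%:R^-1]%classic); last first.
    apply/seteqP; split=> x /=.
      by rewrite in_itv/= => xz n _ /=; rewrite in_itv/= ler_wpDr.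
    move=> h; rewrite in_itv/=; apply/ler_addgt0Pr => e e0.
    have [n _ ne] := @near_infty_natSinv_lt R (PosNum e0).
    have /= := h n I; rewrite in_itv/= => /le_trans; apply.
    by rewrite lerD2l; apply: ltW; exact: (ne n (leqnn _)).
  apply: nonincreasing_cvg_mu => //.
  - by rewrite -ge0_fin_numE ?fin_num_measure.
  - by apply: bigcap_measurable.
  - move=> m n mn; apply/subsetPset => x /=; rewrite !in_itv/= => /le_trans; apply.
    by rewrite lerD2l lef_pV2 ?posrE// ler_nat.
rewrite -(cvg_lim _ h)//; apply: lime_ge; first exact: cvgP h.
apply: nearW => n; have n0 : 0 < n.+1%:R^-1 :> R by [].
have [t /= qt tz] := inf_adherent n0 quantile_has_inf.
apply: (le_trans qt); apply: le_measure; rewrite ?inE//.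
by move=> x /=; rewrite !in_itv/= => /le_trans; apply; exact: ltW.
Qed.

Lemma lt_quantile t : t < quantile P q -> (P `]-oo, t]%classic < q%:E)%E.
Proof.
move=> tz; rewrite ltNge; apply/negP => qt; move: tz; rewrite ltNge => /negP; apply.
by apply: ge_inf => //; exact: quantile_has_inf.2.
Qed.

(** The strict gap between [u] and [t] is the slack exploited in the optimality argument. *)
Lemma quantile_lt t : quantile P q < t ->
  exists2 u, u < t & (q%:E <= P `]-oo, u]%classic)%E.
Proof.
rewrite -subr_gt0 => e0; have [u /= qu] := inf_adherent e0 quantile_has_inf.
by rewrite addrC subrK => ut; exists u.
Qed.

(** The open half-line is the increasing union of closed half-lines ending before the quantile, each
    of probability below [q]. *)
Lemma prob_lt_quantile : (P `]-oo, quantile P q[%classic <= q%:E)%E.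
Proof.
set z := quantile P q.
have h : P `]-oo, z - n.+1%:R^-1]%classic @[n --> \oo] --> P `]-oo, z[%classic.
  rewrite (_ : `]-oo, z[%classic = \bigcup_n `]-oo, z - n.+1%:R^-1]%classic); last first.
    apply/seteqP; split=> x /=; last first.
      by move=> [n _] /=; rewrite !in_itv/= => /le_lt_trans; apply; rewrite ltrBlDr ltrDl.
    rewrite in_itv/= -subr_gt0 => e0.
    have [n _ ne] := @near_infty_natSinv_lt R (PosNum e0).
    exists n => //=; rewrite in_itv/= lerBrDr -lerBrDl; apply: ltW.
    exact: (ne n (leqnn _)).
  apply: nondecreasing_cvg_mu => //; first by apply: bigcup_measurable.
  move=> m n mn; apply/subsetPset => x /=; rewrite !in_itv/= => /le_trans; apply.
  by rewrite lerD2l lerN2 lef_pV2 ?posrE// ler_nat.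
rewrite -(cvg_lim _ h)//; apply: lime_le; first exact: cvgP h.
by apply: nearW => n; apply/ltW/lt_quantile; rewrite ltrBlDr ltrDl.
Qed.

End Quantile.

(** * Step functions as limits of polynomials and of sines *)

Section StepApproximation.
Context {R : realType}.
Implicit Types (w x : R) (n : nat).

Lemma bernoulli_ge x n : -1 <= x -> 1 + n%:R * x <= (1 + x) ^+ n.
Proof.
move=> x1; elim: n => [|n IHn]; first by rewrite mul0r addr0 expr0.
have x0 : 0 <= 1 + x by lra.
rewrite exprS; apply: le_trans (ler_wpM2l x0 IHn).
have n0 : 0 <= n%:R :> R by [].
have x2 : 0 <= x ^+ 2 by exact: sqr_ge0.
have : 0 <= n%:R * x ^+ 2 by exact: mulr_ge0.
rewrite -natr1; nra.
Qed.

(** With [s] the mean of 1 and [x], [x <= s ^+ 2], so [x ^+ n] splits into two factors [s ^+ n];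
    Bernoulli's inequality for [s^-1] bounds [n%:R * s ^+ n], and the other factor tends to 0. *)
Lemma cvg_natM_expr x : 0 <= x < 1 -> (n%:R * x ^+ n) @[n --> \oo] --> (0 : R).
Proof.
move=> /andP[x0 x1]; pose s := (1 + x) / 2.
have s0 : 0 < s by rewrite divr_gt0//; lra.
have s1 : s < 1 by rewrite /s; lra.
have xs : x <= s ^+ 2 by rewrite /s; have := sqr_ge0 (1 - x); nra.
have V1 : 0 < s^-1 - 1 by rewrite subr_gt0 invf_gt1.
apply: (@squeeze_cvgr _ _ _ _ (fun=> 0) (geometric (s^-1 - 1)^-1 s)).
- apply: nearW => n; rewrite mulr_ge0 ?exprn_ge0//= /geometric/=.
  have xsn : x ^+ n <= s ^+ n * s ^+ n.
    by rewrite -expr2 exprAC lerXn2r// ?nnegrE// sqr_ge0.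
  apply: (le_trans (ler_wpM2l (ler0n _ _) xsn)).
  rewrite mulrA ler_wpM2r ?exprn_ge0 ?(ltW s0)//.
  have hb : n%:R * (s^-1 - 1) <= s^-1 ^+ n.
    have := @bernoulli_ge (s^-1 - 1) n; rewrite [X in X ^+ n]addrC subrK => h.
    by apply: le_trans (h _); [rewrite lerDr|lra].
  rewrite -[leRHS]mul1r ler_pdivlMr// mulrAC.
  have /le_trans := ler_wpM2r (exprn_ge0 n (ltW s0)) hb; apply.
  by rewrite -exprMn mulVf ?gt_eqF// expr1n.
- exact: cvg_cst.
- by apply: cvg_geometric; rewrite ger0_norm// ltW.
Qed.

(* On [0, 1] this polynomial in [w] tends to the indicator of [w >= 1/2]. *)
Definition step_poly n w := 1 - (1 - w ^+ n) ^+ (n * 2 ^ n).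

Lemma step_poly_bound n w : 0 <= w <= 1 -> 0 <= step_poly n w <= 1.
Proof.
move=> /andP[w0 w1]; have wn0 : 0 <= w ^+ n by exact: exprn_ge0.
have wn1 : w ^+ n <= 1 by exact: exprn_ile1.
have h0 : 0 <= (1 - w ^+ n) ^+ (n * 2 ^ n) by rewrite exprn_ge0// subr_ge0.
have h1 : (1 - w ^+ n) ^+ (n * 2 ^ n) <= 1 by rewrite exprn_ile1 ?subr_ge0//; lra.
by rewrite /step_poly; apply/andP; split; lra.
Qed.

(** Put [N = n * 2 ^ n], so that [N%:R * w ^+ n = n%:R * (2 * w) ^+ n]. If [w >= 1/2] this is at
    least [n], and [(1 - w ^+ n) ^+ N] is at most the inverse of [(1 + w ^+ n) ^+ N >= n + 1]. If
    [w < 1/2] it tends to 0 and bounds [step_poly n w] by Bernoulli. *)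
Lemma cvg_step_poly w : 0 <= w <= 1 ->
  step_poly n w @[n --> \oo] --> ((1 / 2 <= w)%R%:R : R).
Proof.
move=> /andP[w0 w1]; have [hw|hw] := leP (1 / 2) w.
  apply/subr_cvg0.
  rewrite (_ : (fun n => _) = fun n => - (1 - w ^+ n) ^+ (n * 2 ^ n)); last first.
    by apply/funext => n; rewrite /step_poly addrAC subrr add0r.
  rewrite -oppr0; apply: cvgN.
  apply: (@squeeze_cvgr _ _ _ _ (fun=> 0) harmonic); [|exact: cvg_cst|exact: cvg_harmonic].
  apply: nearW => n.
  have wn0 : 0 <= w ^+ n by exact: exprn_ge0.
  have wn1 : w ^+ n <= 1 by exact: exprn_ile1.
  rewrite exprn_ge0 ?subr_ge0//= /harmonic -[leRHS]mul1r ler_pdivlMr//.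
  have h : n.+1%:R <= (1 + w ^+ n) ^+ (n * 2 ^ n).
    apply: le_trans (bernoulli_ge _ _); last lra.
    rewrite -natr1 addrC lerD2l natrM natrX -mulrA ler_peMr// -exprMn.
    by rewrite exprn_ege1//; lra.
  apply: (le_trans (ler_wpM2l _ h)); first by rewrite exprn_ge0// subr_ge0.
  rewrite -exprMn exprn_ile1//; nra.
apply: (@squeeze_cvgr _ _ _ _ (fun=> 0) (fun n => n%:R * (2 * w) ^+ n)).
- apply: nearW => n; rewrite (andP (step_poly_bound n _)).1 ?w0//=.
  have wn1 : w ^+ n <= 1 by exact: exprn_ile1.
  have := @bernoulli_ge (- w ^+ n) (n * 2 ^ n); rewrite lerN2 => /(_ wn1).
  rewrite /step_poly exprMn natrM natrX => h.
  have -> : n%:R * (2 ^+ n * w ^+ n) = - (n%:R * 2 ^+ n * - w ^+ n) by ring.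
  lra.
- exact: cvg_cst.
- by apply: cvg_natM_expr; apply/andP; split; lra.
Qed.

(** Eventually the argument lies in []-pi, pi[], where the sine has the sign of its argument; the
    sequence is then constant. *)
Lemma cvg_sin_ge0 x :
  (((0 <= sin (n.+1%:R^-1 * x))%R)%:R : R) @[n --> \oo] --> ((0 <= x)%R%:R : R).
Proof.
have hpi : 0 < pi :> R by exact: pi_gt0.
have small : \forall n \near \oo, `|n.+1%:R^-1 * x| < pi.
  have : (n.+1%:R^-1 * x) @[n --> \oo] --> (0 : R).
    by rewrite -[X in _ --> X](mul0r x); apply: cvgMl; exact: cvg_harmonic.
  by move=> /cvgr0_norm_lt /(_ _ hpi).
apply: cvg_near_cst; near=> n.
have : `|n.+1%:R^-1 * x| < pi by near: n.
have n0 : 0 < n.+1%:R^-1 :> R by [].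
rewrite ltr_norml => /andP[l u]; congr (_%:R); congr (nat_of_bool _).
have [x0|x0] := leP 0 x.
  by rewrite sin_ge0_pi// (ltW u) mulr_ge0// ltW.
apply/negbTE; rewrite -ltNge -oppr_gt0 -sinN; apply: sin_gt0_pi.
by rewrite oppr_gt0 pmulr_rlt0// x0/= ltrNl.
Unshelve. all: by end_near. Qed.

End StepApproximation.

(** * Laws on [data H] with equal trigonometric integrals coincide *)

Section Uniqueness.
Context (R : realType) (H : completeNormedModType R).
Variable m : bool -> probability (data H) R.
Hypothesis linear_m : forall i (a : R) (g h : H),
  {ae m i, forall y : data H, y (a *: g + h) = a * y g + y h}.
Hypothesis cos_m : forall (g : H) (t : R),
  \int[m true]_y cos (y g + t) = \int[m false]_y cos (y g + t).

Lemma measurable_coordinate (g : H) :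
  measurable_fun setT (fun y : data H => y g).
Proof.
move=> _ B mB; rewrite setTI; apply: sub_sigma_algebra.
by exists g, B.
Qed.

(* Closing under a.e. equality makes these functions an algebra although the
   coordinates [y g] are only a.e. linear in [g]. *)
Inductive trig : (data H -> R) -> Prop :=
| trig_cst c : trig (fun=> c)
| trig_cos g t : trig (fun y => cos (y g + t))
| trig_lin c f f' : trig f -> trig f' -> trig (fun y => c * f y + f' y)
| trig_ae f f' : measurable_fun setT f' ->
    (forall i, {ae m i, forall y, f y = f' y}) -> trig f -> trig f'.

Lemma measurable_trig f : trig f -> measurable_fun setT f.
Proof.
elim=> [c|g t|c {}f f' _ mf _ mf'|{}f f' mf' _ _ _]//.
- apply: measurableT_comp; first exact: measurable_cos.
  by apply: measurable_funD => //; exact: measurable_coordinate.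
- by apply: measurable_funD => //; exact: measurable_funM.
Qed.

Lemma integrable_trig i f : trig f -> (m i).-integrable setT (EFin \o f).
Proof.
elim=> [c|g t|c {}f f' _ mf _ mf'|{}f f' mf' ff' _ intf]//.
- exact: finite_measure_integrable_cst.
- apply: measurable_bounded_integrable => //.
  + by rewrite -ge0_fin_numE ?fin_num_measure.
  + exact: (measurable_trig (trig_cos g t)).
  + exists 1; split => // u u1 x _ /=; apply: le_trans (ltW u1); exact: cos_max.
- have := integrableD measurableT (integrableZl measurableT c mf) mf'.
  by move=> h; apply: eq_integrable h => // y _.
- have mf : measurable_fun setT (EFin \o f) by exact: measurable_int intf.
  move/integrableP: intf => [_ fin]; apply/integrableP; split.
    by apply/measurable_EFinP.
  rewrite (_ : (\int[m i]_x _)%E = (\int[m i]_x `|(EFin \o f) x|)%E)//.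
  apply: ae_eq_integral => //.
  + by apply: measurableT_comp => //; apply/measurable_EFinP.
  + exact: measurableT_comp.
  + by apply: filterS (ff' i) => y /= ->.
Qed.

Lemma integral_trig f : trig f -> \int[m true]_y f y = \int[m false]_y f y.
Proof.
elim=> [c|g t|c {}f f' tf If tf' If'|{}f f' mf' ff' tf If].
- have E i : \int[m i]_y c = c.
    by rewrite /Rintegral integral_cst// [X in (_ * X)%E](probability_setT (m i)) mule1.
  by rewrite !E.
- exact: cos_m.
- rewrite !RintegralD//; try exact: integrable_trig;
    try exact: integrableZl (integrable_trig _ tf).
  by rewrite !RintegralZl ?If ?If'//; exact: integrable_trig.
- have E i : \int[m i]_y f' y = \int[m i]_y f y.
    congr fine; apply: ae_eq_integral => //; last 1 first.
    + by apply: filterS (ff' i) => y /= ->.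
    + by apply/measurable_EFinP.
    + by apply/measurable_EFinP; exact: measurable_trig.
  by rewrite !E.
Qed.

Lemma trigD f f' : trig f -> trig f' -> trig (fun y => f y + f' y).
Proof.
move=> tf tf'; rewrite (_ : (fun y => _) = fun y => 1 * f y + f' y); first exact: trig_lin.
by apply/funext => y; rewrite mul1r.
Qed.

Lemma trigZ c f : trig f -> trig (fun y => c * f y).
Proof.
move=> tf; rewrite (_ : (fun y => _) = fun y => c * f y + 0).
  by apply: trig_lin => //; exact: trig_cst.
by apply/funext => y; rewrite addr0.
Qed.

(** Double induction; only the product of two cosines has content. *)
Lemma trigM f f' : trig f -> trig f' -> trig (fun y => f y * f' y).
Proof.
move=> tf; elim: tf f' => [c|g t|c {}f h tf IHf th IHh|{}f h mh fh tf IHf] f' tf'.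
- exact: trigZ.
- elim: tf' => [c|g' t'|c {}f' h tf' IHf th IHh|{}f' h mh fh tf' IHf].
  + rewrite (_ : (fun y => _) = fun y => c * cos (y g + t)).
      exact/trigZ/trig_cos.
    by apply/funext => y; rewrite mulrC.
  (* Product-to-sum formula. The coordinates at [g + g'] and [g - g'] are sums and differences only
     up to null sets, hence [trig_ae]. *)
  + pose p (y : data H) := 2^-1 * (cos (y (1 *: g + g') + (t + t')) +
                       cos (y (-1 *: g' + g) + (t - t'))).
    have tp : trig p by apply/trigZ/trigD; exact: trig_cos.
    apply: trig_ae tp.
      by apply: measurable_funM; apply: (measurable_trig (trig_cos _ _)).
    move=> i; apply: filterS2 (linear_m i 1 g g') (linear_m i (-1) g' g) => y e1 e2.
    rewrite /p e1 e2 mul1r mulN1r.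
    have -> : y g + y g' + (t + t') = (y g + t) + (y g' + t') by ring.
    have -> : - y g' + y g + (t - t') = (y g + t) - (y g' + t') by ring.
    by rewrite cosD cosB; field.
  + rewrite (_ : (fun y => _) = fun y => c * (cos (y g + t) * f' y) + cos (y g + t) * h y).
      exact: trig_lin.
    by apply/funext => y; ring.
  + apply: trig_ae IHf => [|i].
      by apply: measurable_funM => //; exact: (measurable_trig (trig_cos g t)).
    by apply: filterS (fh i) => y ->.
- rewrite (_ : (fun y => _) = fun y => c * (f y * f' y) + h y * f' y).
    by apply: trig_lin; [exact: IHf|exact: IHh].
  by apply/funext => y; ring.
- apply: trig_ae (IHf _ tf') => [|i].
    by apply: measurable_funM => //; exact: measurable_trig.
  by apply: filterS (fh i) => y ->.
Qed.

Lemma trigX f n : trig f -> trig (fun y => f y ^+ n).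
Proof.
move=> tf; elim: n => [|n IHn].
  by rewrite (_ : (fun y => _) = fun=> 1); [exact: trig_cst|apply/funext => y; rewrite expr0].
rewrite (_ : (fun y => _) = fun y => f y * f y ^+ n); first exact: trigM.
by apply/funext => y; rewrite exprS.
Qed.

Lemma trig_onem f : trig f -> trig (fun y => 1 - f y).
Proof.
move=> tf; rewrite (_ : (fun y => _) = fun y => -1 * f y + 1).
  by apply: trig_lin => //; exact: trig_cst.
by apply/funext => y; ring.
Qed.

Lemma trig_step_poly n f : trig f -> trig (fun y => step_poly n (f y)).
Proof. by move=> tf; apply/trig_onem/trigX/trig_onem/trigX. Qed.

(** Testing against every [f] in [trig], and not only against constants, makes the property survive
    multiplication by further indicators. The bound by 1 gives dominated convergence. *)
Definition trig_determined (p : data H -> R) :=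
  [/\ measurable_fun setT p, (forall y, `|p y| <= 1) &
    forall f, trig f -> \int[m true]_y (p y * f y) = \int[m false]_y (p y * f y)].

Lemma integrable_Mtrig i (p f : data H -> R) :
  measurable_fun setT p -> (forall y, `|p y| <= 1) -> trig f ->
  (m i).-integrable setT (fun y => (p y * f y)%:E).
Proof.
move=> mp p1 tf; apply: le_integrable (integrable_trig i tf) => //.
  by apply/measurable_EFinP; apply: measurable_funM => //; exact: measurable_trig.
by move=> y _; rewrite lee_fin normrM ler_piMl.
Qed.

Lemma trig_determined_lim (p_ : nat -> data H -> R) (p : data H -> R) :
  (forall n, trig_determined (p_ n)) ->
  (forall y, p_ n y @[n --> \oo] --> p y) -> trig_determined p.
Proof.
move=> dp pp.
have mp : measurable_fun setT p.
  by apply: (measurable_fun_cvg (h := p_)) => [n|y _]; [case: (dp n)|exact: pp].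
have p1 y : `|p y| <= 1.
  have h : `|p_ n y| @[n --> \oo] --> `|p y| by apply: cvg_norm; exact: pp.
  rewrite -(cvg_lim _ h)//.
  apply: limr_le; first exact: cvgP h.
  by apply: nearW => n; have [_ + _] := dp n; exact.
split=> // f tf.
have C i : \int[m i]_y (p_ n y * f y) @[n --> \oo] --> \int[m i]_y (p y * f y).
  apply: fine_cvg; rewrite fineK; last first.
    by apply: integrable_fin_num => //; exact: integrable_Mtrig.
  apply: (@dominated_cvg _ _ _ (m i) _ _ (fun n y => (p_ n y * f y)%:E) _
    (abse \o (EFin \o f))) => //=.
  - move=> n; have [mpn pn1 _] := dp n.
    exact: measurable_int (integrable_Mtrig i mpn pn1 tf).
  - by move=> y _; apply: cvg_EFin; [exact: nearW|apply: cvgMl; exact: pp].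
  - exact: integrable_abse (integrable_trig i tf).
  - move=> n y _; rewrite lee_fin normrM ler_piMl//.
    by have [_ + _] := dp n; exact.
apply: cvg_unique (C true) _ => //.
rewrite (_ : (fun n => _) = fun n => \int[m false]_y (p_ n y * f y)); first exact: C.
by apply/funext => n; have [_ _] := dp n; exact.
Qed.

(** [step_poly n (w y)] is again in [trig], so it can be absorbed into the test function; the
    indicator is its limit. *)
Lemma trig_determined_threshold p w :
  trig_determined p -> trig w -> (forall y, 0 <= w y <= 1) ->
  trig_determined (fun y => p y * (1 / 2 <= w y)%R%:R).
Proof.
move=> [mp p1 dp] tw w01.
apply: (@trig_determined_lim (fun n y => p y * step_poly n (w y))) => [n|y]; last first.
  by apply: cvgMr; exact: cvg_step_poly.
have ts := trig_step_poly n tw.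
split.
- by apply: measurable_funM => //; exact: measurable_trig.
- move=> y; rewrite normrM mulr_ile1//.
  by have /andP[s0 s1] := step_poly_bound n (w01 y); rewrite ger0_norm.
move=> f tf; have := dp _ (trigM ts tf).
by under eq_Rintegral do rewrite mulrA; under [X in _ = X]eq_Rintegral do rewrite mulrA.
Qed.

Lemma coordinateZ i (a : R) (g : H) : {ae m i, forall y : data H, y (a *: g) = a * y g}.
Proof.
apply: filterS2 (linear_m i a g 0) (linear_m i 1 0 0) => y.
by rewrite addr0 scaler0 addr0 mul1r => -> e; lra.
Qed.

Lemma trig_determined_halfspace p (g : H) (b : R) :
  trig_determined p -> trig_determined (fun y => p y * (b <= y g)%R%:R).
Proof.
move=> dp.
(* Rescaled to lie in [[0, 1]], so that [1 / 2 <= w n y] says exactly that the sine is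
   nonnegative. *)
pose w n (y : data H) := 2^-1 * sin (n.+1%:R^-1 * (y g - b)) + 2^-1.
have tw n : trig (w n).
  apply: trig_lin; last exact: trig_cst.
  (* A sine is a cosine with phase [- pi / 2], and the division by [n.+1] is moved onto [g]. *)
  apply: trig_ae (trig_cos (n.+1%:R^-1 *: g) (- (n.+1%:R^-1 * b) - pi / 2)) => [|i].
    apply: measurableT_comp; first exact: measurable_sin.
    apply: measurable_funM => //; apply: measurable_funB => //.
    exact: measurable_coordinate.
  apply: filterS (coordinateZ i n.+1%:R^-1 g) => y ->.
  by rewrite addrA cosBpihalf -mulrBr.
have w01 n y : 0 <= w n y <= 1.
  have := sin_le1 (n.+1%:R^-1 * (y g - b)); have := sin_geN1 (n.+1%:R^-1 * (y g - b)).
  by rewrite /w => *; apply/andP; split; lra.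
apply: trig_determined_lim (fun n => trig_determined_threshold dp (tw n) (w01 n)) _ => y.
apply: cvgMr; have := @cvg_sin_ge0 R (y g - b); rewrite subr_ge0.
rewrite (_ : (fun n => (0 <= sin _)%R%:R) = fun n => (1 / 2 <= w n y)%R%:R)//.
apply/funext => n; rewrite /w; congr (_%:R); congr (nat_of_bool _).
by apply/idP/idP; lra.
Qed.

(** Quantifying over all determined [p] makes this family closed under intersection, by applying the
    property twice. *)
Let G : set (set (data H)) := [set A | measurable A /\
  forall p, trig_determined p -> trig_determined (fun y => p y * \1_A y)].

(** Both laws agree on the pi-system [G] (take [p] and [f] equal to 1), and [G] generates the
    sigma-algebra because it contains the half-spaces. *)
Lemma data_measure_unique (A : set (data H)) : measurable A -> m true A = m false A.
Proof.
have G_T : G setT.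
  split=> // p dp; rewrite (_ : (fun y => _) = p)//.
  by apply/funext => y; rewrite indicT mulr1.
have G_I : setI_closed G.
  move=> B C [mB dB] [mC dC]; split; first exact: measurableI.
  move=> p dp; rewrite (_ : (fun y => _) = fun y => p y * \1_B y * \1_C y).
    exact/dC/dB.
  by apply/funext => y; rewrite indicI mulrA.
have d1 : trig_determined (fun=> 1).
  split=> // [y|f tf]; first by rewrite normr1.
  by under eq_Rintegral do rewrite mul1r; under [RHS]eq_Rintegral do rewrite mul1r;
    exact: integral_trig.
have G_half g b : G [set y : data H | b <= y g].
  split.
    rewrite -[X in measurable X]setTI.
    rewrite (_ : [set y | _] = (fun y : data H => y g) @^-1` `[b, +oo[); last first.
      by apply/seteqP; split=> y /=; rewrite in_itv/= andbT.
    exact: measurable_coordinate.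
  move=> p dp; rewrite (_ : (fun y => _) = fun y => p y * (b <= y g)%R%:R).
    exact: trig_determined_halfspace.
  apply/funext => y; rewrite indicE; congr (_ * (nat_of_bool _)%:R).
  by apply/idP/idP; rewrite inE.
have GE : @measurable _ (data H) = <<s G >>.
  apply/seteqP; split; last by apply: smallest_sub; [exact: sigma_algebra_measurable|move=> B []].
  apply: smallest_sub; first exact: smallest_sigma_algebra.
  move=> _ [g [B [mB ->]]].
  (* Half-lines generate the Borel sets, so a coordinate is measurable for [<<s G >>] once its
     half-spaces lie in [G]. *)
  have mg : @measurable_fun _ _ (g_sigma_algebraType G) R setT (fun y => y g).
    apply: (measurability _ (RGenCInfty.measurableE R)) => //.
    move=> _ [_ [b ->] <-]; apply: sub_sigma_algebra; rewrite setTI.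
    have := G_half g b; congr (G _).
    by apply/seteqP; split=> y /=; rewrite in_itv/= andbT.
  by have := mg measurableT B mB; rewrite setTI.
apply: (measure_unique G (fun=> setT)) => //.
- by rewrite bigcup_const.
- move=> B [mB dB]; have [_ _ dB1] := dB _ d1; have := dB1 _ (trig_cst 1).
  under eq_Rintegral do rewrite mul1r mulr1.
  under [RHS]eq_Rintegral do rewrite mul1r mulr1.
  have E i : \int[m i]_x \1_B x = fine (m i B) by rewrite /Rintegral integral_indic// setIT.
  rewrite !E => h.
  transitivity (fine (m true B))%:E; first by rewrite fineK// fin_num_measure.
  by rewrite h fineK// fin_num_measure.
- by move=> _; rewrite -ge0_fin_numE ?fin_num_measure.
Qed.

End Uniqueness.

(** * Integrals of cosines and of affine inequalities under a probability *)

Section CosineIntegral.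
Context d (T : measurableType d) (R : realType) (Q : probability T R).
Implicit Types (f : T -> R).

Lemma measurable_cos_comp f :
  measurable_fun setT f -> measurable_fun setT (fun w => cos (f w)).
Proof. by move=> mf; apply: measurableT_comp => //; exact: measurable_cos. Qed.

Lemma integrable_cos f : measurable_fun setT f ->
  Q.-integrable setT (fun w => (cos (f w))%:E).
Proof.
move=> mf; apply: measurable_bounded_integrable => //.
- by rewrite -ge0_fin_numE ?fin_num_measure.
- exact: measurable_cos_comp.
- exists 1; split => // v v1 x _ /=; apply: le_trans (ltW v1); exact: cos_max.
Qed.

Lemma Rintegral_cos_ae f f' : measurable_fun setT f -> measurable_fun setT f' ->
  {ae Q, forall w, f w = f' w} -> \int[Q]_w cos (f w) = \int[Q]_w cos (f' w).
Proof.
move=> mf mf' ff'; congr fine; apply: ae_eq_integral => //.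
- by apply/measurable_EFinP; exact: measurable_cos_comp.
- by apply/measurable_EFinP; exact: measurable_cos_comp.
- by apply: filterS ff' => w /= ->.
Qed.

End CosineIntegral.

(** Serves to integrate the one-dimensional testing bound over the conditioning variable; constants
    are their own integrals under a probability. *)
Lemma le_integral_affine d (T : measurableType d) (R : realType)
    (P : probability T R) (F F' : T -> \bar R) (c c' k : R) :
  measurable_fun setT F -> measurable_fun setT F' ->
  (forall w, 0 <= F w)%E -> (forall w, 0 <= F' w)%E -> 0 <= c -> 0 <= c' -> 0 <= k ->
  (forall w, F' w + c%:E <= c'%:E + k%:E * F w)%E ->
  (\int[P]_w F' w + c%:E <= c'%:E + k%:E * \int[P]_w F w)%E.
Proof.
move=> mF mF' F0 F'0 c0 c'0 k0 FF'.
have c_int (x : R) : (\int[P]_w x%:E = x%:E)%E.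
  by rewrite integral_cst// [X in (_ * X)%E](probability_setT P) mule1.
rewrite -[X in (_ + X <= _)%E]c_int -[X in (_ <= X + _)%E]c_int.
rewrite -ge0_integralZl// -!ge0_integralD//; last 2 first.
- by move=> w _; rewrite mule_ge0.
- exact: emeasurable_funM.
apply: ge0_le_integral => //.
- by move=> w _; rewrite adde_ge0.
- exact: emeasurable_funD.
- by apply: emeasurable_funD => //; exact: emeasurable_funM.
Qed.

(** * Transfer of uniqueness to processes on different probability spaces *)

Section ProcessLaw.
Context (R : realType) (H : completeNormedModType R).

Lemma measurable_to_data d (T : measurableType d) (Y : T -> data H) :
  (forall g, measurable_fun setT (fun w => Y w g)) -> measurable_fun setT Y.
Proof.
move=> mY; have E : @measurable _ (data H) = <<s @cylinders R H >> by [].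
apply: (measurability _ E).
move=> _ [_ [g [B [mB ->]]] <-]; rewrite setTI.
by have := mY g measurableT B mB; rewrite setTI.
Qed.

Lemma process_law_unique d1 (T1 : measurableType d1) (P1 : probability T1 R)
    d2 (T2 : measurableType d2) (P2 : probability T2 R)
    (Y1 : T1 -> data H) (Y2 : T2 -> data H) :
  measurable_fun setT Y1 -> measurable_fun setT Y2 ->
  (forall a g h, {ae P1, forall w, Y1 w (a *: g + h) = a * Y1 w g + Y1 w h}) ->
  (forall a g h, {ae P2, forall w, Y2 w (a *: g + h) = a * Y2 w g + Y2 w h}) ->
  (forall g t, \int[P1]_w cos (Y1 w g + t) = \int[P2]_w cos (Y2 w g + t)) ->
  forall B, measurable B -> P1 (Y1 @^-1` B) = P2 (Y2 @^-1` B).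
Proof.
move=> mY1 mY2 l1 l2 c12 B mB.
pose X1 : {RV P1 >-> data H} := HB.pack Y1 (isMeasurableFun.Build _ _ _ _ Y1 mY1).
pose X2 : {RV P2 >-> data H} := HB.pack Y2 (isMeasurableFun.Build _ _ _ _ Y2 mY2).
pose m b : probability (data H) R :=
  if b then (distribution P1 X1 : probability _ _) else (distribution P2 X2 : probability _ _).
have ae_m d (T : measurableType d) (P : probability T R) (X : {RV P >-> data H}) a g h :
    {ae P, forall w, X w (a *: g + h) = a * X w g + X w h} ->
    {ae distribution P X, forall y : data H, y (a *: g + h) = a * y g + y h}.
  move=> [N [mN N0 NX]].
  pose D (y : data H) := y (a *: g + h) - (a * y g + y h) : R.
  have mD : measurable_fun setT D.
    apply: measurable_funB; first exact: measurable_coordinate.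
    apply: measurable_funD; last exact: measurable_coordinate.
    by apply: measurable_funM => //; exact: measurable_coordinate.
  (* The exceptional set for the image law must be measurable in [data H]; this one is, and its
     preimage lies in the null set [N]. *)
  pose A := D @^-1` (~` [set 0]).
  have mA : measurable A.
    by rewrite -[X in measurable X]setTI; apply: mD => //; exact: measurableC.
  exists A; split => //.
    apply/eqP; rewrite -measure_le0 -N0.
    change (P (X @^-1` A) <= P N)%E.
    apply: le_measure; rewrite ?inE//.
      by rewrite -[X in measurable X]setTI; exact: measurable_funPT.
    move=> w Dw; apply: NX => /= e; apply: Dw.
    by rewrite /D /= e subrr.
  move=> y /= ny D0; apply: ny.
  by move/eqP: D0; rewrite /D subr_eq0 => /eqP.
have cos_int d (T : measurableType d) (P : probability T R) (X : {RV P >-> data H}) g t :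
    \int[distribution P X]_y cos ((y : data H) g + t) = \int[P]_w cos (X w g + t).
  have mc : measurable_fun setT (fun y : data H => cos (y g + t)).
    apply: measurableT_comp; first exact: measurable_cos.
    by apply: measurable_funD => //; exact: measurable_coordinate.
  rewrite /Rintegral integral_distribution//; first by apply/measurable_EFinP.
  apply: (@integrable_cos _ _ _ P (fun w => X w g + t)).
  apply: measurable_funD => //.
  exact: (measurableT_comp (measurable_coordinate g)).
have := @data_measure_unique R H m _ _ B mB; apply.
  by case=> a g h; apply: ae_m; [exact: l1|exact: l2].
by move=> g t; rewrite /m !cos_int; exact: c12.
Qed.

End ProcessLaw.

(** * Resampling one Gaussian coordinate and testing a shift along it *)

Section GaussianShift.
Context (R : realType) (H : completeNormedModType R).
Context (ip : {dot H for (@idfun R)}) (ip_norm : forall h : H, ip h h = `|h| ^+ 2).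
Context d (Omega : measurableType d) (P : probability Omega R).
Context (W : H -> {RV P >-> R}) (W_gauss : standard_gaussian W).
Implicit Types (g h u : H) (a r t : R).

Lemma ipC g h : ip g h = ip h g.
Proof. by rewrite (hermC ip) /= expr0 mul1r. Qed.

Lemma ipZDr x a g h : ip x (a *: g + h) = a * ip x g + ip x h.
Proof. by rewrite linearDr linearZr_LR. Qed.

Lemma ipZDl x a g h : ip (a *: g + h) x = a * ip g x + ip h x.
Proof. by rewrite ipC ipZDr !(ipC x). Qed.

Lemma gaussian0 : {ae P, forall w, W 0 w = 0}.
Proof.
apply: filterS (W_gauss.1 1 0 0) => w.
by rewrite scaler0 addr0 mul1r => e; lra.
Qed.

Lemma gaussianZ a g : {ae P, forall w, W (a *: g) w = a * W g w}.
Proof.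
apply: filterS2 gaussian0 (W_gauss.1 a g 0) => w w0.
by rewrite addr0 w0 addr0.
Qed.

Lemma gaussian_unit u (A : set R) : `|u| = 1 -> measurable A ->
  P (W u @^-1` A) = normal_prob 0 1 A.
Proof.
move=> u1 mA; have := W_gauss.2 u A mA.
by rewrite /distribution /pushforward /= u1 /centered_normal oner_eq0.
Qed.

(** Normalizing [g] reduces to a unit vector, whose coordinate is standard normal; [g = 0] is
    separate because it cannot be normalized. *)
Lemma gaussian_cos g t :
  \int[P]_w cos (W g w + t) = cos t * expR (- `|g| ^+ 2 / 2).
Proof.
have [->|g0] := eqVneq g 0.
  rewrite normr0 expr0n/= oppr0 mul0r expR0 mulr1.
  rewrite (@Rintegral_cos_ae _ _ _ _ _ (fun=> t)) //; last 2 first.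
  - exact: measurable_funD.
  - by apply: filterS gaussian0 => w ->; rewrite add0r.
  by rewrite /Rintegral integral_cst// [X in (_ * X)%E](probability_setT P) mule1.
have ng0 : `|g| != 0 by rewrite normr_eq0.
pose u := `|g|^-1 *: g.
have u1 : `|u| = 1 by rewrite normrZ normfV normr_id mulVf.
have gE : g = `|g| *: u by rewrite scalerA divff// scale1r.
have ml : measurable_fun setT (fun x : R => cos (`|g| * x + t)).
  apply: measurableT_comp; first exact: measurable_cos.
  by apply: measurable_funD => //; exact: measurable_funM.
rewrite -integral_cos_normal.
rewrite (@Rintegral_cos_ae _ _ _ _ _ (fun w => `|g| * W u w + t)); last first.
- by apply: filterS (gaussianZ `|g| u) => w; rewrite -gE => ->.
- by apply: measurable_funD => //; exact: measurable_funM.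
- exact: measurable_funD.
have mWu : measurable_fun setT (W u : Omega -> measurableTypeR R).
  by move=> _ A mA; exact: (@measurable_funPT _ _ _ _ (W u)).
have icos : P.-integrable setT (EFin \o (fun w => cos (`|g| * W u w + t))).
  apply: (@integrable_cos _ _ _ P (fun w => `|g| * W u w + t)).
  by apply: measurable_funD => //; exact: measurable_funM.
have := @integral_pushforward _ _ _ (measurableTypeR R) R _ mWu P setT
  (fun x => (cos (`|g| * x + t))%:E) _ icos measurableT.
move=> /(_ _); rewrite /Rintegral preimage_setT => <-; last by apply/measurable_EFinP.
congr fine; apply: eq_measure_integral => A mA _.
exact: (gaussian_unit u1 mA).
Qed.

Lemma gaussian_cosZ sigma g t :
  \int[P]_w cos (sigma * W g w + t) = cos t * expR (- (sigma * `|g|) ^+ 2 / 2).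
Proof.
rewrite -[(sigma * _) ^+ 2]real_normK ?num_real// normrM normr_id -normrZ -gaussian_cos.
apply: Rintegral_cos_ae.
- by apply: measurable_funD => //; exact: measurable_funM.
- exact: measurable_funD.
- by apply: filterS (gaussianZ sigma g) => w ->.
Qed.

Context (V : lmodType R) (K : {linear V -> H}) (sigma : R).
Implicit Types (f : V).

Lemma measurable_observe f : measurable_fun setT (observe K ip W sigma f).
Proof.
apply: measurable_to_data => g; apply: measurable_funD => //.
exact: measurable_funM.
Qed.

(* [observe f] with the noise coordinate along [u] resampled. *)
Definition resample f u (z : Omega * R) : data H :=
  fun g => ip (K f) g + sigma * (W g z.1 + ip u g * (z.2 - W u z.1)).

Lemma measurable_resample f u : measurable_fun setT (resample f u).
Proof.
have mW g : measurable_fun setT (fun z : Omega * R => W g z.1).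
  exact: measurableT_comp.
apply: measurable_to_data => g; apply: measurable_funD => //.
apply: measurable_funM => //; apply: measurable_funD => //.
by apply: measurable_funM => //; exact: measurable_funB.
Qed.

(** The resampled term is surely linear in [g], so the exceptional set is that of [W] times the
    whole line. *)
Lemma resample_linear f u a g h :
  {ae (P \x normal_prob (0 : R) 1)%E, forall z,
    resample f u z (a *: g + h) = a * resample f u z g + resample f u z h}.
Proof.
have [N [mN N0 NW]] := W_gauss.1 a g h.
exists (N `*` setT); split.
- exact: measurableX.
- by rewrite product_measure1E// [X in (X * _)%E]N0 mul0e.
move=> z /= nz; split=> //; apply: NW => /= e; apply: nz.
rewrite /resample e !ipZDr; ring.
Qed.

(** Integrating the fresh coordinate produces the Gaussian factor of the component of [g] along [u];
    the remaining noise lives on the orthogonal component, and the two exponents add up to that of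
    [g]. *)
Lemma cos_resample f u g t : `|u| = 1 ->
  \int[(P \x normal_prob (0 : R) 1)%E]_z cos (resample f u z g + t) =
  \int[P]_w cos (observe K ip W sigma f w g + t).
Proof.
move=> u1; set c := ip u g.
have -> : \int[P]_w cos (observe K ip W sigma f w g + t) =
    cos (ip (K f) g + t) * expR (- (sigma * `|g|) ^+ 2 / 2).
  rewrite -gaussian_cosZ; apply: eq_Rintegral => w _; congr cos.
  by rewrite /observe; ring.
have mz : measurable_fun setT (fun z => resample f u z g + t).
  apply: measurable_funD => //.
  exact: (measurableT_comp (measurable_coordinate g) (measurable_resample f u)).
have iz : (P \x normal_prob (0 : R) 1)%E.-integrable setT
    (fun z => (cos (resample f u z g + t))%:E).
  exact: (@integrable_cos _ _ _ (P \x normal_prob (0 : R) 1)%E _ mz).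
rewrite /Rintegral -integral12_prod_meas1//.
pose b w := ip (K f) g + sigma * (W g w - c * W u w) + t.
transitivity (\int[P]_w (cos (b w) * expR (- (sigma * c) ^+ 2 / 2))).
  congr fine; apply: eq_integral => w _; rewrite /fubini_F.
  rewrite -integral_cos_normal /Rintegral fineK.
    apply: eq_integral => x _; congr (cos _)%:E.
    by rewrite /resample /b -/c /=; ring.
  apply: integrable_fin_num => //.
  apply: (@integrable_cos _ _ _ (normal_prob (0 : R) 1) (fun x => sigma * c * x + b w)).
  by apply: measurable_funD => //; exact: measurable_funM.
have mb : measurable_fun setT b.
  apply: measurable_funD => //; apply: measurable_funD => //.
  apply: measurable_funM => //; apply: measurable_funB => //.
  exact: measurable_funM.
rewrite RintegralZr//; last first.
  exact: (@integrable_cos _ _ _ P _ mb).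
rewrite (@Rintegral_cos_ae _ _ _ _ _
  (fun w => sigma * W (- c *: u + g) w + (ip (K f) g + t)))//; last 2 first.
- by apply: measurable_funD => //; exact: measurable_funM.
- by apply: filterS (W_gauss.1 (- c) u g) => w ->; rewrite /b; ring.
rewrite gaussian_cosZ -mulrA -expRD; congr (_ * expR _).
(* Pythagoras: [g - c *: u] is orthogonal to the unit vector [u]. *)
have -> : (sigma * `|- c *: u + g|) ^+ 2 = sigma ^+ 2 * (`|g| ^+ 2 - c ^+ 2).
  rewrite exprMn -!ip_norm ipZDl !ipZDr.
  by rewrite (ipC g u) -/c ip_norm u1; ring.
by field.
Qed.

Lemma observe_resample f u (B : set (data H)) : `|u| = 1 -> measurable B ->
  P (observe K ip W sigma f @^-1` B) =
  (\int[P]_w normal_prob (0 : R) 1 [set x | B (resample f u (w, x))])%E.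
Proof.
move=> u1 mB.
have := @process_law_unique R H _ _ P _ _ (P \x normal_prob (0 : R) 1)%E
  (observe K ip W sigma f) (resample f u) (measurable_observe f) (measurable_resample f u).
move=> -> //; last 3 first.
- move=> a g h; apply: filterS (W_gauss.1 a g h) => w e.
  by rewrite /observe e ipZDr; ring.
- exact: resample_linear.
- by move=> g t; rewrite cos_resample.
apply: eq_integral => w _; congr (normal_prob _ _ _).
by apply/seteqP; split => x /=; rewrite xsectionE.
Qed.

(** With the rest of the noise frozen, passing from [f] to [f'] only translates the resampled
    coordinate, so [neyman_pearson_normal] applies to every section of [B]; integration over [w]
    concludes. *)
Lemma neyman_pearson_observe f f' u r (z : R) (B : set (data H)) :
  0 < sigma -> `|u| = 1 -> 0 <= r -> K f' = K f + r *: u -> measurable B ->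
  (P (observe K ip W sigma f' @^-1` B) +
     (expR (r / sigma * z - (r / sigma) ^+ 2 / 2))%:E * (Phi (- z))%:E <=
   (Phi (r / sigma - z))%:E +
     (expR (r / sigma * z - (r / sigma) ^+ 2 / 2))%:E *
     P (observe K ip W sigma f @^-1` B))%E.
Proof.
move=> s0 u1 r0 Kf' mB; set a := r / sigma; set k := expR _.
have a0 : 0 <= a by rewrite divr_ge0// ltW.
pose S w : set R := [set x | B (resample f u (w, x))].
have mS w : measurable (S w).
  rewrite -[S w]setTI; apply: (measurableT_comp (measurable_resample f u)) => //.
(* Adding [r *: u] to the mean moves coordinate [g] by [r * ip u g], which is the effect of shifting
   the fresh noise by [r / sigma]. *)
have S' w : [set x | B (resample f' u (w, x))] = (fun x => x + a) @^-1` S w.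
  apply/seteqP; split=> x; rewrite /S /=;
  (rewrite (_ : resample f' u (w, x) = resample f u (w, x + a))//);
  by apply/funext => g; rewrite /resample Kf' [K f + _]addrC ipZDl /= /a; field; rewrite gt_eqF.
rewrite !(observe_resample _ u1 mB).
under eq_integral do rewrite S'.
have mf (g : V) :
    measurable_fun setT (fun w => normal_prob (0 : R) 1 [set x | B (resample g u (w, x))]).
  have mR : measurable (resample g u @^-1` B).
    by rewrite -[X in measurable X]setTI; exact: measurable_resample.
  have := measurable_fun_xsection (normal_prob (0 : R) 1) mR.
  by under [X in measurable_fun _ X -> _]eq_fun do rewrite /= xsectionE.
have mf' :
    measurable_fun setT (fun w => normal_prob (0 : R) 1 ((fun x => x + a) @^-1` S w)).
  by have := mf f'; congr (measurable_fun _ _); apply/funext => w; rewrite S'.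
have kPhi0 : 0 <= k * Phi (- z) by rewrite mulr_ge0 ?expR_ge0// ltW// Phi_gt0.
have Phi0 : 0 <= Phi (a - z) by rewrite ltW// Phi_gt0.
rewrite -EFinM; apply: le_integral_affine => //; [exact: expR_ge0|move=> w].
rewrite EFinM -normal_prob_itvcy.
have -> : (Phi (a - z))%:E = normal_prob (0 : R) 1 ((fun x => x + a) @^-1` `[z, +oo[).
  have -> : a - z = - (z - a) by ring.
  rewrite -normal_prob_itvcy; congr (normal_prob _ _ _).
  by apply/seteqP; split=> x /=; rewrite !in_itv/= !andbT lerBlDr.
exact: neyman_pearson_normal.
Qed.

End GaussianShift.

(** * Almost sure comparison of events and quantiles of normal variables *)

Lemma le_measure_ae d (T : measurableType d) (R : realType)
    (P : {measure set T -> \bar R}) (A B : set T) :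
  measurable A -> measurable B -> {ae P, forall w, A w -> B w} -> (P A <= P B)%E.
Proof.
move=> mA mB [N [mN N0 AN]].
have AB : A `<=` B `|` N.
  move=> w Aw; have [Bw|nBw] := pselect (B w); first by left.
  by right; apply: AN => /= /(_ Aw).
apply: (@le_trans _ _ (P (B `|` N))).
  by apply: le_measure => //; rewrite inE//; exact: measurableU.
by rewrite (le_trans (measureU2 _ mB mN))// [X in (_ + X <= _)%E]N0 adde0.
Qed.

Lemma eq_measure_ae d (T : measurableType d) (R : realType)
    (P : {measure set T -> \bar R}) (A B : set T) :
  measurable A -> measurable B -> {ae P, forall w, A w <-> B w} -> P A = P B.
Proof.
move=> mA mB AB; apply/eqP; rewrite eq_le.
by apply/andP; split; apply: le_measure_ae => //; apply: filterS AB => w [].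
Qed.

(** The case [b = 0] is included because the slope of the modulus may vanish. *)
Lemma quantile_affine_normal d (T : measurableType d) (R : realType)
    (P : probability T R) (X Z : T -> R) (a b q : R) :
  measurable_fun setT X -> measurable_fun setT Z -> 0 <= b ->
  (forall A, measurable A -> P (Z @^-1` A) = normal_prob (0 : R) 1 A) ->
  {ae P, forall w, X w = a + b * Z w} ->
  quantile (pushforward P X) (Phi q) = a + b * q.
Proof.
move=> mX mZ b0 lawZ XZ; rewrite /quantile.
have mXt t : measurable (X @^-1` `]-oo, t]).
  by rewrite -[X in measurable X]setTI; exact: mX.
have mS (S : set R) : measurable S -> measurable (Z @^-1` S).
  by move=> mS; rewrite -[X in measurable X]setTI; exact: mZ.
suff -> : [set t | ((Phi q)%:E <= pushforward P X `]-oo, t]%classic)%E] =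
    `[a + b * q, +oo[%classic.
  by rewrite inf_itv.
apply/seteqP; split => t; rewrite /= in_itv/= andbT /pushforward.
  (* For [b = 0] the law is the point mass at [a], and [0 < Phi q] excludes every [t < a]. *)
  have [bE|bn0] := eqVneq b 0.
    move=> h; rewrite bE mul0r addr0 leNgt; apply/negP => ta; move: h.
    have -> : P (X @^-1` `]-oo, t]) = P set0.
      apply: eq_measure_ae => //; apply: filterS XZ => w /= ->.
      by rewrite bE mul0r addr0 in_itv/= leNgt ta.
    by rewrite measure0 lee_fin leNgt Phi_gt0.
  have bp : 0 < b by rewrite lt_neqAle eq_sym bn0.
  have -> : P (X @^-1` `]-oo, t]) = P (Z @^-1` `]-oo, (t - a) / b]).
    apply: eq_measure_ae => //; first exact: mS.
    by apply: filterS XZ => w /= ->; rewrite !in_itv/= ler_pdivlMr// mulrC lerBrDl.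
  rewrite lawZ// -PhiE lee_fin => hq; rewrite leNgt; apply/negP => ta; move: hq.
  rewrite leNgt => /negP; apply; apply: Phi_lt.
  by rewrite ltr_pdivrMr// mulrC ltrBlDl.
move=> ta; have [bE|bn0] := eqVneq b 0.
  have -> : P (X @^-1` `]-oo, t]) = P setT.
    apply: eq_measure_ae => //; apply: filterS XZ => w /= ->.
    by rewrite bE mul0r addr0 in_itv/=; move: ta; rewrite bE mul0r addr0 => ->.
  by rewrite probability_setT lee_fin ltW// Phi_lt1.
have bp : 0 < b by rewrite lt_neqAle eq_sym bn0.
have -> : P (X @^-1` `]-oo, t]) = P (Z @^-1` `]-oo, (t - a) / b]).
  apply: eq_measure_ae => //; first exact: mS.
  by apply: filterS XZ => w /= ->; rewrite !in_itv/= ler_pdivlMr// mulrC lerBrDl.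
by rewrite lawZ// -PhiE lee_fin Phi_le// ler_pdivlMr// mulrC lerBrDl.
Qed.

(** * Tail bounds at the normal quantile *)

Section NormalQuantile.
Context (R : realType) (alpha : R) (alpha_gt0 : 0 < alpha) (alpha_lt1 : alpha < 1).

Lemma Phi_z_ge : 1 - alpha <= Phi (z_ (1 - alpha)).
Proof.
rewrite -lee_fin PhiE; apply: (@quantile_le_prob R (normal_prob 0 1));
  by rewrite ?subr_gt0// ltrBlDr ltrDl.
Qed.

(** Complement of [prob_lt_quantile]; it bounds from below the null probability of the half-line in
    the Neyman-Pearson inequality. *)
Lemma PhiN_z_ge : alpha <= Phi (- z_ (1 - alpha)).
Proof.
rewrite -lee_fin -normal_prob_itvcy -setCitvl probability_setC//.
have gen (x : \bar R) : x \is a fin_num -> (x <= (1 - alpha)%:E -> alpha%:E <= 1 - x)%E.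
  by case: x => //= x _; rewrite -EFinB !lee_fin lerBrDr -lerBrDl.
apply: gen; first exact: fin_num_measure.
by apply: (@prob_lt_quantile R (normal_prob 0 1)); rewrite ?subr_gt0// ltrBlDr ltrDl.
Qed.

End NormalQuantile.

(** * Supporting affine bounds for [L] on [F] *)

Section ModulusBounds.
Context (R : realType) (V : lmodType R) (F : set V) (H : completeNormedModType R).
Context (ip : {dot H for (@idfun R)}) (ip_norm : forall h : H, ip h h = `|h| ^+ 2).
Context (K : {linear V -> H}) (L : {scalar V}) (F_convex : @convex_set R V F).
Context (delta : R) (delta_gt0 : 0 < delta).
Context (slope : R) (slope_superdiff : superdifferential K L F delta slope).
Context (fs gs : V) (fs_gs_attain : attains_modulus K L F delta fs gs).
Context (fs_gs_dist : `|K (fs - gs)| = delta).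

Local Notation h := (K (gs - fs)).

Lemma convex_segment (x y : V) (t : R) : 0 <= t -> t <= 1 -> F x -> F y ->
  F (x + t *: (y - x)).
Proof.
move=> t0 t1 Fx Fy; have := @F_convex y x (Itv01 t0 t1); rewrite !inE => /(_ Fy Fx).
congr F; rewrite /conv/= /unstable.onem scalerBl scale1r scalerBr.
by rewrite addrC -addrA [- _ + _]addrC.
Qed.

Lemma norm_h : `|h| = delta.
Proof. by rewrite -fs_gs_dist -normrN -linearN opprB. Qed.

Lemma modulus_deltaE : modulus K L F delta = (L gs - L fs)%:E.
Proof. by have [_ _ _ ->] := fs_gs_attain. Qed.

Lemma le_modulus eta (f g : V) : F f -> F g -> `|K (g - f)| <= eta ->
  ((L g - L f)%:E <= modulus K L F eta)%E.
Proof. by move=> Ff Fg fg; apply: ereal_sup_ubound; exists f, g. Qed.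

(** The pair [fs], [gs] stays feasible at distance [2 * delta], so the superdifferential inequality
    there gives [0 <= slope * delta]. *)
Lemma slope_ge0 : 0 <= slope.
Proof.
have [Ff Fg hd _] := fs_gs_attain.
have d2 : 0 < 2 * delta by rewrite mulr_gt0.
have : `|h| <= 2 * delta by rewrite norm_h; lra.
move=> /(le_modulus Ff Fg)/le_trans/(_ (slope_superdiff d2)).
rewrite modulus_deltaE -EFinD lee_fin -(pmulr_lge0 _ delta_gt0); lra.
Qed.

(* First order condition at [t = 0+] for the concave function
   [t |-> modulus |h + t k|]. *)
Lemma superdifferential_direction (D : R) (k : H) :
  (forall t, 0 < t -> t < 1 ->
     ((t * D + (L gs - L fs))%:E <= modulus K L F (`|h + t *: k|)%R)%E) ->
  D <= slope / delta * ip h k.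
Proof.
move=> HD; apply/ler_addgt0Pr => e e0.
have s0 := slope_ge0.
pose M := slope * `|k| ^+ 2 / (2 * delta).
have M0 : 0 <= M by rewrite divr_ge0// ?mulr_ge0// ?sqr_ge0// ltW.
(* One summand for each demand on [t = c^-1]: [t < 1], then [t * |k| < delta] so that [eta > 0], and
   a second-order error [t * M] of at most [e]. *)
pose c := 2 + `|k| / delta + M / e.
have kd0 : 0 <= `|k| / delta by rewrite divr_ge0// ltW.
have Me0 : 0 <= M / e by rewrite divr_ge0// ltW.
have c0 : 0 < c by rewrite /c; lra.
pose t := c^-1.
have t0 : 0 < t by rewrite invr_gt0.
have t1 : t < 1 by rewrite invf_lt1// /c; lra.
have tk : t * `|k| < delta.
  rewrite mulrC ltr_pdivrMr// mulrC -ltr_pdivrMr//; rewrite /c; lra.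
have tM : t * M <= e.
  rewrite mulrC ler_pdivrMr// mulrC -ler_pdivrMr// /c; lra.
set eta := `|h + t *: k|.
have eta0 : 0 < eta.
  rewrite /eta (lt_le_trans _ (lerB_normD _ _))// subr_gt0 norm_h normrZ gtr0_norm//.
have eta2 : eta ^+ 2 = delta ^+ 2 + 2 * t * ip h k + t ^+ 2 * `|k| ^+ 2.
  have -> : eta ^+ 2 = ip (t *: k + h) (t *: k + h) by rewrite ip_norm addrC.
  by rewrite ipZDr !ipZDl !ip_norm norm_h (ipC ip k h); ring.
(* Tangent bound for the square root: [eta - delta] is at most
   [(eta ^+ 2 - delta ^+ 2) / (2 * delta)], the defect being a square. *)
have etaB : eta - delta <= t * (ip h k / delta + t * `|k| ^+ 2 / (2 * delta)).
  rewrite -subr_ge0.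
  rewrite (_ : _ - _ = (eta - delta) ^+ 2 / (2 * delta)) ?divr_ge0 ?sqr_ge0//; last first.
    apply: (mulIf (lt0r_neq0 delta_gt0)); apply: (mulIf (lt0r_neq0 delta_gt0)).
    have -> : (eta - delta) ^+ 2 = eta ^+ 2 - 2 * eta * delta + delta ^+ 2 by ring.
    by rewrite eta2; field; rewrite gt_eqF.
  by rewrite mulr_ge0 ?ltW.
have := le_trans (HD t t0 t1) (slope_superdiff eta0).
rewrite modulus_deltaE -EFinD lee_fin => h1.
have h2 : t * D <= slope * (t * (ip h k / delta + t * `|k| ^+ 2 / (2 * delta))).
  by apply: (@le_trans _ _ (slope * (eta - delta))); [lra|exact: ler_wpM2l].
have h3 : t * D <= t * (slope / delta * ip h k + t * M).
  apply: le_trans h2 _; rewrite le_eqVlt; apply/orP; left; apply/eqP.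
  by rewrite /M; field; rewrite gt_eqF.
rewrite ler_pM2l// in h3.
by apply: le_trans h3 _; rewrite lerD2l.
Qed.

(** Moving [fs] towards [f] while keeping [gs] gives feasible pairs, to which the first order
    condition applies. *)
Lemma L_ge_lower f : F f ->
  L fs + slope / delta * ip h (K (f - fs)) <= L f.
Proof.
move=> Ff; have [Ffs Fgs _ _] := fs_gs_attain.
have : L fs - L f <= slope / delta * ip h (K (fs - f)).
  apply: superdifferential_direction => t t0 t1.
  have -> : t * (L fs - L f) + (L gs - L fs) = L gs - L (fs + t *: (f - fs)).
    by rewrite linearD linearZ_LR linearB /=; ring.
  apply: le_modulus => //; first by apply: convex_segment => //; exact: ltW.
  rewrite -linearZ_LR -linearD le_eqVlt; apply/orP; left; apply/eqP; congr (`|K _|).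
  by rewrite opprD addrA -scalerN opprB.
by rewrite -[fs - f]opprB linearN/= linearNr mulrN; lra.
Qed.

(** Here [gs] moves towards [f] and [fs] is kept. *)
Lemma L_le_upper f : F f ->
  L f <= L gs + slope / delta * ip h (K (f - gs)).
Proof.
move=> Ff; have [Ffs Fgs _ _] := fs_gs_attain.
have : L f - L gs <= slope / delta * ip h (K (f - gs)).
  apply: superdifferential_direction => t t0 t1.
  have -> : t * (L f - L gs) + (L gs - L fs) = L (gs + t *: (f - gs)) - L fs.
    by rewrite linearD linearZ_LR linearB /=; ring.
  apply: le_modulus => //; first by apply: convex_segment => //; exact: ltW.
  rewrite -linearZ_LR -linearD le_eqVlt; apply/orP; left; apply/eqP; congr (`|K _|).
  by rewrite addrAC.
lra.
Qed.

End ModulusBounds.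

(** * Coverage, excess length and optimality of the interval *)

Section Procedure.
Context (R : realType) (V : lmodType R) (F : set V) (H : completeNormedModType R).
Context (ip : {dot H for (@idfun R)}) (ip_norm : forall h : H, ip h h = `|h| ^+ 2).
Context (K : {linear V -> H}) (L : {scalar V}).
Context d (Omega : measurableType d) (P : probability Omega R).
Context (W : H -> {RV P >-> R}) (W_gauss : standard_gaussian W).
Context (sigma : R) (sigma_gt0 : 0 < sigma).
Context (alpha : R) (alpha_gt0 : 0 < alpha) (alpha_lt1 : alpha < 1).
Context (F_convex : @convex_set R V F) (delta : R) (delta_gt0 : 0 < delta).
Context (slope : R) (slope_superdiff : superdifferential K L F delta slope).
Context (fs gs : V) (fs_gs_attain : attains_modulus K L F delta fs gs).
Context (fs_gs_dist : `|K (fs - gs)| = delta).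

Local Notation h := (K (gs - fs)).
Local Notation u := (delta^-1 *: h).
Local Notation z := (z_ (1 - alpha)).
Local Notation c_opt := (c_hat K L F ip sigma alpha delta slope fs gs).
Local Notation obs := (observe K ip W sigma).
Local Notation beta := (Phi (delta / sigma - z)).

Lemma norm_u : `|u| = 1.
Proof.
by rewrite normrZ (norm_h fs_gs_dist) gtr0_norm ?invr_gt0// mulVf// gt_eqF.
Qed.

Lemma measurable_excess (c : data H -> R) (f : V) : measurable_fun setT c ->
  measurable_fun setT (fun w => L f - c (obs f w)).
Proof.
move=> mc; apply: measurable_funB => //.
exact: (measurableT_comp mc (measurable_observe ip W K sigma f)).
Qed.

Lemma measurable_c_opt : measurable_fun setT (c_opt : data H -> R).
Proof.
apply: measurable_funB => //; apply: measurable_funB => //.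
apply: measurable_funD => //; apply: measurable_funM => //.
by apply: measurable_funB => //; exact: measurable_coordinate.
Qed.

(* Mean of [L f - c_opt] under [f], apart from the term [slope * sigma * z]. *)
Definition mean_excess (f : V) : R :=
  (L gs - L fs - delta * slope) -
  (L gs + slope / delta * ip h (K (f - gs)) - L f).

(** The noise is written through [- u] so that its coefficient [slope * sigma] is nonnegative, as
    the quantile formula requires. The constants combine through [ip h h = delta ^+ 2] and the
    midpoint having image [K fs + h / 2]. *)
Lemma excess_c_opt (f : V) :
  {ae P, forall w, L f - c_opt (obs f w) =
    (mean_excess f + slope * sigma * z) + slope * sigma * W (- u) w}.
Proof.
have hE : h = (- delta) *: (- u).
  by rewrite scalerN scaleNr opprK scalerA divff ?gt_eqF// scale1r.
apply: filterS (gaussianZ W_gauss (- delta) (- u)) => w; rewrite -hE => Wh.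
rewrite /c_hat /L_hat /observe (modulus_deltaE fs_gs_attain)/= Wh /mean_excess.
have hh : ip h (K gs) = ip h (K fs) + delta ^+ 2.
  have : ip h h = ip h (K gs) - ip h (K fs) by rewrite [X in ip _ X]linearB linearBr.
  by rewrite ip_norm (norm_h fs_gs_dist); lra.
have -> : ip h (K (2^-1 *: (fs + gs))) = ip h (K fs) + delta ^+ 2 / 2.
  have -> : K (2^-1 *: (fs + gs)) = 2^-1 *: K fs + 2^-1 *: K gs.
    by rewrite linearZ_LR linearD scalerDr.
  by rewrite ipZDr [ip _ (_ *: _)]linearZr_LR /= hh; field.
have -> : ip h (K (f - gs)) = ip h (K f) - ip h (K fs) - delta ^+ 2.
  by rewrite [K (f - gs)]linearB [ip _ (_ - _)]linearBr /= hh; ring.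
have -> : L (2^-1 *: (fs + gs)) = 2^-1 * (L fs + L gs) by rewrite linearZ_LR linearD.
rewrite (ipC ip (K f)).
by field; rewrite gt_eqF.
Qed.

Lemma mean_excess_ge0 f : F f -> 0 <= mean_excess f.
Proof.
move=> Ff; have := L_ge_lower ip_norm F_convex delta_gt0 slope_superdiff
  fs_gs_attain fs_gs_dist Ff.
have hh : ip h (K (f - fs)) = ip h (K (f - gs)) + delta ^+ 2.
  have -> : K (f - fs) = K (f - gs) + h by rewrite -linearD addrA subrK.
  by rewrite [ip _ (_ + _)]linearDr /= ip_norm (norm_h fs_gs_dist).
rewrite hh /mean_excess.
have -> : slope / delta * (ip h (K (f - gs)) + delta ^+ 2) =
    slope / delta * ip h (K (f - gs)) + delta * slope by field; rewrite gt_eqF.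
lra.
Qed.

Lemma mean_excess_le f : F f -> mean_excess f <= L gs - L fs - delta * slope.
Proof.
move=> Ff; have := L_le_upper ip_norm F_convex delta_gt0 slope_superdiff
  fs_gs_attain fs_gs_dist Ff.
by rewrite /mean_excess; lra.
Qed.

Lemma mean_excess_gs : mean_excess gs = L gs - L fs - delta * slope.
Proof. by rewrite /mean_excess subrr !linear0 mulr0; ring. Qed.

Let slope0 : 0 <= slope := slope_ge0 delta_gt0 slope_superdiff fs_gs_attain fs_gs_dist.

(** Since the mean excess is nonnegative on [F], coverage holds almost surely whenever [W (- u)] is
    at least [- z]. *)
Lemma c_opt_ci : one_sided_ci K L F ip W sigma alpha c_opt.
Proof.
split; first exact: measurable_c_opt.
apply: le_ereal_inf_tmp => _ [f Ff <-].
have mE := measurable_excess f measurable_c_opt.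
have mset : measurable [set w | L f \in `[c_opt (obs f w), +oo[].
  rewrite (_ : [set w | _] = (fun w => L f - c_opt (obs f w)) @^-1` `[0, +oo[).
    by rewrite -[X in measurable X]setTI; exact: mE.
  by apply/seteqP; split=> w /=; rewrite !in_itv/= !andbT subr_ge0.
have mW : measurable (W (- u) @^-1` `[- z, +oo[).
  by rewrite -[X in measurable X]setTI; exact: measurable_funPT.
apply: (@le_trans _ _ (P (W (- u) @^-1` `[- z, +oo[))).
  rewrite (gaussian_unit W_gauss)// ?normrN ?norm_u// normal_prob_itvcy opprK lee_fin.
  exact: Phi_z_ge.
apply: le_measure_ae => //; apply: filterS (excess_c_opt f) => w e /=.
rewrite !in_itv/= !andbT => zW; rewrite -subr_ge0 e.
rewrite -addrA -mulrDr addr_ge0 ?mean_excess_ge0// mulr_ge0//.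
  by rewrite mulr_ge0// ltW.
by rewrite -lerBlDl sub0r.
Qed.

(** The choice of [beta] makes the normal quantile [delta / sigma - z]; its [z] cancels the one in
    the mean, leaving [slope * delta]. *)
Lemma excess_quantile_c_opt f :
  excess_quantile K L ip W sigma beta c_opt f = mean_excess f + delta * slope.
Proof.
rewrite /excess_quantile.
rewrite (@quantile_affine_normal _ _ _ P _ (W (- u))
  (mean_excess f + slope * sigma * z) (slope * sigma)).
- by field; rewrite gt_eqF.
- exact: (measurable_excess f measurable_c_opt).
- exact: measurable_funPT.
- by rewrite mulr_ge0// ltW.
- by move=> A mA; rewrite (gaussian_unit W_gauss)// normrN norm_u.
- exact: excess_c_opt.
Qed.

Lemma max_excess_quantile_c_opt :
  max_excess_quantile K L F ip W sigma beta c_opt = modulus K L F delta.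
Proof.
have [Ffs Fgs _ _] := fs_gs_attain.
rewrite (modulus_deltaE fs_gs_attain).
apply/eqP; rewrite eq_le; apply/andP; split.
  apply: ge_ereal_sup => _ [f Ff <-].
  rewrite excess_quantile_c_opt lee_fin; have := mean_excess_le Ff; lra.
apply: ereal_sup_ubound; exists gs => //.
by rewrite excess_quantile_c_opt mean_excess_gs subrK.
Qed.

(* Testing [gs] against a point strictly inside the segment [fs, gs], rather
   than against [fs], makes the Neyman-Pearson bound strict. *)
Lemma modulus_le_excess_quantile (c : data H -> R) :
  one_sided_ci K L F ip W sigma alpha c ->
  (modulus K L F delta <= (excess_quantile K L ip W sigma beta c gs)%:E)%E.
Proof.
move=> [mc cov]; have [Ffs Fgs _ _] := fs_gs_attain.
rewrite (modulus_deltaE fs_gs_attain) lee_fin leNgt; apply/negP => qlt.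
have mX := measurable_excess gs mc.
have mX' : measurable_fun setT
    ((fun w => L gs - c (obs gs w)) : Omega -> measurableTypeR R).
  by move=> _ A mA; exact: mX.
pose X : {RV P >-> measurableTypeR R} := HB.pack
  (fun w => L gs - c (obs gs w) : measurableTypeR R)
  (isMeasurableFun.Build _ _ _ _ _ mX').
have [t tlt] := @quantile_lt R (distribution P X) beta (Phi_gt0 _) (Phi_lt1 _) _ qlt.
rewrite /distribution /pushforward /=.
pose B : set (data H) := [set y | L gs - c y <= t].
have mB : measurable B.
  rewrite -[B]setTI; rewrite (_ : B = (fun y => L gs - c y) @^-1` `]-oo, t]); last first.
    by apply/seteqP; split=> y /=; rewrite in_itv.
  exact: measurable_funB.
move=> qt; have betaB : (beta%:E <= P (obs gs @^-1` B))%E.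
  have -> : obs gs @^-1` B = X @^-1` `]-oo, t].
    by apply/seteqP; split=> w /=; rewrite in_itv.
  exact: qt.
(* The weight [l] is small enough that [l * w0 < e], hence [L f' < L gs - t] at the point [f']
   below. *)
pose w0 := L gs - L fs; pose e := w0 - t; pose l := e / (2 * (e + `|w0|)).
have e0 : 0 < e by rewrite subr_gt0.
have w0n : 0 <= `|w0| by [].
have l0 : 0 < l by rewrite divr_gt0// mulr_gt0//; lra.
have l1 : l < 1 by rewrite ltr_pdivrMr; lra.
have lw : l * w0 < e.
  apply: (@le_lt_trans _ _ (l * `|w0|)); first by rewrite ler_wpM2l ?ler_norm// ltW.
  rewrite /l mulrAC ltr_pdivrMr; last lra.
  rewrite ltr_pM2l//; lra.
pose f' := fs + l *: (gs - fs).
have Ff' : F f' by apply: convex_segment => //; exact: ltW.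
have Kgs : K gs = K f' + ((1 - l) * delta) *: u.
  rewrite scalerA -mulrA divff ?gt_eqF// mulr1 /f' -linearZ_LR -linearD; congr (K _).
  by rewrite scalerBl scale1r addrACA subrr addr0 addrCA subrr addr0.
have r0 : 0 <= (1 - l) * delta by rewrite mulr_ge0 ?subr_ge0// ltW.
have NP := neyman_pearson_observe ip_norm W_gauss z sigma_gt0 norm_u r0 Kgs mB.
have mobsB f : measurable (obs f @^-1` B).
  by rewrite -[X in measurable X]setTI; apply: measurable_observe.
have size : (P (obs f' @^-1` B) <= alpha%:E)%E.
  pose C := [set w | L f' \in `[c (obs f' w), +oo[].
  have mC : measurable C.
    rewrite (_ : C = (fun w => L f' - c (obs f' w)) @^-1` `[0, +oo[).
      by rewrite -[X in measurable X]setTI; exact: measurable_excess.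
    by apply/seteqP; split=> w; rewrite /C /= !in_itv/= !andbT subr_ge0.
  have PC : ((1 - alpha)%:E <= P C)%E.
    by apply: (le_trans cov); apply: ereal_inf_lbound; exists f'.
  (* On [B] the endpoint is at least [L gs - t > L f'], so the interval misses [L f']. *)
  have BC : obs f' @^-1` B `<=` ~` C.
    move=> w; rewrite /B /C /= in_itv/= andbT => Bw Cw.
    have Lf' : L f' = L fs + l * w0 by rewrite /f' linearD linearZ_LR linearB.
    by move: Cw Bw lw; rewrite Lf' /e /w0; lra.
  apply: (@le_trans _ _ (P (~` C))).
    by apply: le_measure; rewrite ?inE//; exact: measurableC.
  rewrite probability_setC//.
  have gen (x : \bar R) : x \is a fin_num -> ((1 - alpha)%:E <= x -> 1 - x <= alpha%:E)%E.
    by case: x => //= x _; rewrite -EFinB !lee_fin; lra.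
  by apply: gen => //; exact: fin_num_measure.
(* The shift from [f'] to [gs] is [(1 - l) * delta], strictly less than [delta]. *)
have strict : Phi ((1 - l) * delta / sigma - z) < beta.
  apply: Phi_lt; rewrite ltrD2r ltr_pM2r ?invr_gt0//.
  by rewrite gtr_pMl// ltrBlDr ltrDl.
move: NP strict size betaB (PhiN_z_ge alpha_gt0 alpha_lt1) (mobsB gs) (mobsB f').
move=> NP strict size betaB zge mg mf'.
(* Contradiction in real terms: [y <= alpha <= q] turns the testing bound into [x <= p], against
   [p < b <= x]. *)
have gen (x y : \bar R) (k p q b : R) : x \is a fin_num -> y \is a fin_num ->
    0 <= k -> alpha <= q -> p < b ->
    (x + k%:E * q%:E <= p%:E + k%:E * y -> y <= alpha%:E -> b%:E <= x -> False)%E.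
  case: x => //= x _; case: y => //= y _ k0 aq pb.
  by rewrite -!EFinM -!EFinD !lee_fin; nra.
apply: (gen _ _ _ _ _ _ _ _ _ zge strict NP size betaB).
- exact: fin_num_measure.
- exact: fin_num_measure.
- exact: expR_ge0.
Qed.

End Procedure.

Theorem corollary3p1
  (R : realType) (V : lmodType R) (F : set V) (H : completeNormedModType R)
  (ip : {dot H for (@idfun R)}) (ip_norm : forall h : H, ip h h = `|h| ^+ 2)
  (K : {linear V -> H}) (L : {scalar V})
  (d : measure_display) (Omega : measurableType d) (P : probability Omega R)
  (W : H -> {RV P >-> R}) (W_gauss : standard_gaussian W)
  (sigma : R) (sigma_gt0 : 0 < sigma)
  (alpha : R) (alpha_gt0 : 0 < alpha) (alpha_lt1 : alpha < 1)
  (F_convex : @convex_set R V F)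
  (delta : R) (delta_gt0 : 0 < delta)
  (slope : R) (slope_superdiff : superdifferential K L F delta slope)
  (fs gs : V) (fs_gs_attain : attains_modulus K L F delta fs gs)
  (fs_gs_dist : `|K (fs - gs)| = delta) :
  let c_opt := c_hat K L F ip sigma alpha delta slope fs gs in
  let beta := Phi (delta / sigma - z_ (1 - alpha)) in
  [/\ one_sided_ci K L F ip W sigma alpha c_opt,
      (forall c : data H -> R, one_sided_ci K L F ip W sigma alpha c ->
         (max_excess_quantile K L F ip W sigma beta c_opt
          <= max_excess_quantile K L F ip W sigma beta c)%E)
    & max_excess_quantile K L F ip W sigma beta c_opt = modulus K L F delta].
Proof.
move=> c_opt beta.
have maxE : max_excess_quantile K L F ip W sigma beta c_opt = modulus K L F delta.
  exact: max_excess_quantile_c_opt.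
split=> //; first exact: c_opt_ci.
move=> c ci; rewrite maxE.
(* The lower bound is already reached at the single point [gs], which belongs to [F]. *)
apply: (@le_trans _ _ (excess_quantile K L ip W sigma beta c gs)%:E).
  exact: (modulus_le_excess_quantile ip_norm W_gauss sigma_gt0 alpha_gt0 alpha_lt1
    F_convex delta_gt0 fs_gs_attain fs_gs_dist ci).
by have [_ Fgs _ _] := fs_gs_attain; apply: ereal_sup_ubound; exists gs.
Qed.
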